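(* Let $\mathbb{F}$ be a field. The family $(\sigma_{n,m}(\mathrm{R}_{n,m}))_{n,m\ge1}$, with $\sigma_{n,m}(\mathrm{R}_{n,m})\subset\mathbb{P}^{nN(n,m)-1}$ the image of the universal circuit resultant $\mathrm{R}_{n,m}\subset\mathbb{P}^{n-1}\times\mathbb{P}^{N(n,m)-1}$ under the Segre embedding $\sigma_{n,m}:\mathbb{P}^{n-1}\times\mathbb{P}^{N(n,m)-1}\to\mathbb{P}^{nN(n,m)-1}$, $\sigma_{n,m}([x_i]_i,[t_j]_j)=[x_it_j]_{i,j}$, is $\mathrm{NP}_{\mathrm{proj}}$-complete (after re-indexing to a single-indexed sequence): it is in $\mathrm{NP}_{\mathrm{proj}}$, and every sequence in $\mathrm{NP}_{\mathrm{proj}}$ reduces to it.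
   Context: Conventions. $\mathbb{F}$ is any field; $\mathbb{P}^n$ is projective $n$-space over $\mathbb{F}$, and zero-sets are sets of points with coordinates in $\mathbb{F}$. A function $\mathbb{N}\to\mathbb{N}$ is polynomially bounded if it is bounded above by a polynomial. Arithmetic circuits. An arithmetic circuit over $\mathbb{F}$ is a labeled directed acyclic multigraph. Nodes of in-degree $0$ (input gates, leaves) are labeled by input variables or constants of $\mathbb{F}$; every other node is a sum gate or a product gate; every edge carries a weight in $\mathbb{F}$. A sum (resp. product) gate whose incoming edges have weights $\lambda_i$ and come from gates computing $f_i$ computes $\sum_i\lambda_i f_i$ (resp. $\prod_i \lambda_i f_i$). Gates with no outgoing edges are output gates. The size is the number of edges. A circuit is bi-homogeneous with respect to a partition of the variables into two groups (variables of bi-degree $(1,0)$ and of bi-degree $(0,1)$) if every gate computes a bi-homogeneous polynomial. For varieties in $\mathbb{P}^{n_1}\times\mathbb{P}^{n_2}$, ''homogeneous'' means bi-homogeneous in the two sets of homogeneous coordinates. Classes. A sequence $(X_n\subset\mathbb{P}^{\mathrm{n}_1(n)}\times\mathbb{P}^{\mathrm{n}_2(n)})_{n\ge1}$, with $\mathrm{n}_1,\mathrm{n}_2$ polynomially bounded, is in $\mathrm{P}_{\mathrm{proj}}$ if there is a sequence of homogeneous circuits, of size polynomially bounded in $n$, whose outputs are homogeneous polynomials, of number and degree polynomially bounded in $n$, with zero-set $X_n$. (Sequences in a single projective space are the case $\mathrm{n}_2=0$.) A sequence $(X_n\subset\mathbb{P}^{\mathrm{n}_1(n)})$ is in $\mathrm{NP}_{\mathrm{proj}}$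 if there is a sequence $(Y_n\subset\mathbb{P}^{\mathrm{n}_1(n)}\times\mathbb{P}^{\mathrm{n}_2(n)})$ in $\mathrm{P}_{\mathrm{proj}}$ such that $X_n$ is the image of $Y_n$ under the projection to $\mathbb{P}^{\mathrm{n}_1(n)}$. Reductions. A projective-linear map $\mathbb{P}^{n_1}\times\dots\times\mathbb{P}^{n_a}\to\mathbb{P}^{m_1}\times\dots\times\mathbb{P}^{m_b}$ is a map each of whose components is either constant or a (well-defined) linear map depending on only one of the factors $\mathbb{P}^{n_i}$. A sequence $(X_n)$ reduces to $(Y_n)$ if there are a polynomially bounded $p:\mathbb{N}\to\mathbb{N}$ and projective-linear maps $\rho_n$ from the ambient space of $X_n$ to the ambient space of $Y_{p(n)}$ with $\rho_n^{-1}(Y_{p(n)})=X_n$ for all $n$. $(X_n)$ is $\mathcal{C}$-hard if every sequence in $\mathcal{C}$ reduces to it, and $\mathcal{C}$-complete if moreover it is in $\mathcal{C}$. Universal circuits. Fix a sufficiently large absolute integer constant $c\ge1$ (it accounts for the constant-factor cost of putting circuits in normal form). Given $n,m,s\ge 1$ and $(r_1,r_2)\neq(0,0)$, the circuit $\Phi^{(r_1,r_2)}$ has input variables $x_1,\dots,x_n$ (bi-degree $(1,0)$) and $y_1,\dots,y_m$ (bi-degree $(0,1)$), and for every $(l_1,l_2)\ne(0,0)$ with $0\le l_i\le r_i$ a sum-level $(l_1,l_2)$ of sum gates and, if $(l_1,l_2)\notin\{(1,0),(0,1)\}$, a product-level $(l_1,l_2)$ of product gates. Product-level $(l_1,l_2)$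 has, for each type $(j_1,j_2)$ with $0\le j_i\le l_i$ and $(j_1,j_2)\neq (0,0),(l_1,l_2)$, exactly $cs$ product gates, each of fan-in $2$, taking one input from a sum gate in sum-level $(j_1,j_2)$ and the other from a sum gate in sum-level $(l_1-j_1,l_2-j_2)$. Every sum gate has fan-out at most $1$, so each input of each product gate comes from its own sum gate, and each sum-level below $(r_1,r_2)$ contains exactly the sum gates needed for this. Every sum gate in sum-level $(l_1,l_2)$ has an incoming edge from each product gate in product-level $(l_1,l_2)$; every sum gate in sum-level $(1,0)$ has an incoming edge from each $x_i$, and every sum gate in sum-level $(0,1)$ from each $y_i$. Sum-level $(r_1,r_2)$ consists of $n$ sum gates, which are the outputs. The circuit $\Phi_{n,m,r,s}$ is the union, sharing only the input gates, of $\Phi^{(r_1,r_2)}$ over all $(r_1,r_2)\ne(0,0)$ with $0\le r_1,r_2\le r$. The circuit $\Phi'_{n,m,r,s}$ is obtained from $\Phi_{n,m,r,s}$ by introducing, for each edge $e$, a new input variable $t_e$ (control variable), splitting $e$ into two and inserting in the middle a product gate that multiplies by $t_e$; all edges of $\Phi'_{n,m,r,s}$ have weight $1$. Let $N=N(n,m,r,s)$ be the number of control variables. The outputs of $\Phi'_{n,m,r,s}$ are tri-homogeneous in the $x$-, $y$- and $t$-variables; let $Z_{n,m,r,s}\subset\mathbb{P}^{n-1}\times\mathbb{P}^{m-1}\times\mathbb{P}^{N-1}$ be their common zero-set. Universal circuit resultant. $\mathrm{R}_{n,m,r,s}=\pi_{1,3}(Z_{n,m,r,s})\subset\mathbb{P}^{n-1}\times\mathbb{P}^{N-1}$,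 where $\pi_{1,3}$ is the projection omitting the middle factor $\mathbb{P}^{m-1}$. Set $\mathrm{R}_{n,m}:=\mathrm{R}_{n,m,n,n^2+n+m}$ (that is, $r=n$ and $s=n^2+n+m$) and $N(n,m):=N(n,m,n,n^2+n+m)$. Re-indexing. The doubly indexed family is turned into a sequence by a standard enumeration of all pairs $(n,m)$ in which the position of $(n,m)$ is at most quadratic in $n+m$. *)

(* Defs.v *)
From HB Require Import structures.
From mathcomp Require Import all_boot all_order all_algebra.
From mathcomp Require Import zify.
From mathcomp Require Import mpoly.

Set Implicit Arguments.
Unset Strict Implicit.
Unset Printing Implicit Defensive.

Import GRing.Theory.
Local Open Scope ring_scope.

Definition poly_bounded (f : nat -> nat) : Prop :=
  exists q : {poly nat}, forall n, (f n <= q.[n])%N.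

(** * Projective spaces *)

(* [proj F k] is the set of lines through the origin of F^k, i.e. the
   projective space P^{k-1}: the index is the number of homogeneous
   coordinates, not the dimension. It is empty for k = 0. *)
Definition proj (F : fieldType) (k : nat) : Type :=
  {L : {vspace 'rV[F]_k} | \dim L == 1}.

(* [v] is a vector of homogeneous coordinates of the point [p]. *)
Definition represents (F : fieldType) (k : nat) (v : 'rV[F]_k)
    (p : proj F k) : bool :=
  (v != 0) && (v \in val p).

Lemma represents_ex (F : fieldType) (k : nat) (p : proj F k) :
  exists v, represents v p.
Proof.
exists (vpick (val p)); rewrite /represents memv_pick andbT vpick0.
by case: p => L /= dL; rewrite -dimv_eq0 (eqP dL).
Qed.

Lemma represents_line (F : fieldType) (k : nat) (v : 'rV[F]_k) (p : proj F k) :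
  represents v p = (v != 0) && (val p == <[v]>%VS).
Proof.
rewrite /represents; case: eqP => //= /eqP v0.
apply/idP/eqP => [vp | ->]; last exact: memv_line.
apply/eqP; rewrite eq_sym eqEdim -memvE vp dim_vline v0.
by case: p {vp} => L /= /eqP ->.
Qed.

Lemma represents_exists_point (F : fieldType) (k : nat) (v : 'rV[F]_k) :
  v != 0 -> exists p : proj F k, represents v p.
Proof.
move=> v0; have dv : \dim <[v]>%VS == 1 by rewrite dim_vline v0.
by exists (exist _ <[v]>%VS dv); rewrite represents_line v0 /= eqxx.
Qed.

Definition meval_row (F : fieldType) (k : nat) (f : {mpoly F[k]})
    (v : 'rV[F]_k) : F := f.@[fun i => v 0 i].

(* Asking a "linear" map to send representatives to representatives forces
   [A] to be injective, i.e. the map to be well defined everywhere. *)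
Definition projective_linear (F : fieldType) (k l : nat)
    (rho : proj F k -> proj F l) : Prop :=
  (exists q, forall p, rho p = q) \/
  (exists A : 'M[F]_(k, l),
     forall p v, represents v p -> represents (v *m A) (rho p)).

(** * Arithmetic circuits *)

Inductive gate (F : fieldType) (k : nat) : Type :=
| InVar of 'I_k
| InConst of F
| SumGate
| ProdGate.
Arguments InVar {F k}.
Arguments InConst {F k}.
Arguments SumGate {F k}.
Arguments ProdGate {F k}.

Definition is_input (F : fieldType) (k : nat) (g : gate F k) : bool :=
  match g with InVar _ | InConst _ => true | _ => false end.

Record circuit (F : fieldType) (k : nat) : Type := Circuit {
  node : finType;
  edge : finType;
  src : edge -> node;
  tgt : edge -> node;
  weight : edge -> F;
  label : node -> gate F k }.

Section CircuitTheory.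
Variables (F : fieldType) (k : nat) (C : circuit F k).

Definition edge_rel : rel (node C) :=
  fun u v => [exists e : edge C, (src e == u) && (tgt e == v)].

Definition acyclic : Prop :=
  forall e : edge C, ~~ connect edge_rel (tgt e) (src e).

Definition is_circuit : Prop :=
  acyclic /\
  forall v : node C, is_input (label v) = [forall e : edge C, tgt e != v].

Definition circuit_size : nat := #|edge C|.

Definition outputs : {set node C} := [set v | [forall e : edge C, src e != v]].

Definition gate_step (val : node C -> {mpoly F[k]}) (v : node C) : {mpoly F[k]} :=
  match label v with
  | InVar i => 'X_i
  | InConst a => a%:MP
  | SumGate => \sum_(e : edge C | tgt e == v) weight e *: val (src e)
  | ProdGate => \prod_(e : edge C | tgt e == v) (weight e *: val (src e))
  end.

(* The polynomial computed at a gate. In an acyclic circuit #|node C| rounds of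
   bottom-up evaluation reach the fixpoint, see [gate_polyE]. *)
Definition gate_poly : node C -> {mpoly F[k]} :=
  iter #|node C| gate_step (fun=> 0).

Definition output_degree : nat :=
  \max_(v in outputs) (msize (gate_poly v)).-1.

Lemma acyclic_of_height (h : node C -> nat) :
  (forall e : edge C, (h (src e) < h (tgt e))%N) -> acyclic.
Proof.
move=> hP e; apply/negP => /connectP [p pth lst].
have := hP e; rewrite lst ltnNge => /negP; apply.
move: (tgt e) pth => v0 {lst}; elim: p v0 => //= u p IH v /andP [/existsP [f /andP [/eqP sv /eqP tu]] pth].
by apply: leq_trans (IH _ pth); apply: ltnW; rewrite -sv -tu.
Qed.

Definition height (v : node C) : nat := #|[set u | connect edge_rel u v]|.

Lemma height_edge : acyclic -> forall e : edge C, (height (src e) < height (tgt e))%N.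
Proof.
move=> ac e; apply: proper_card; apply/properP; split.
  apply/subsetP => u; rewrite !inE => /connect_trans; apply.
  by apply: connect1; apply/existsP; exists e; rewrite !eqxx.
by exists (tgt e); rewrite !inE ?connect0 // (negPf (ac e)).
Qed.

Lemma gate_polyE : acyclic -> forall v, gate_poly v = gate_step gate_poly v.
Proof.
move=> ac.
have stab j : forall i v, (height v <= j)%N -> (j <= i)%N ->
    iter i gate_step (fun=> 0) v = iter j gate_step (fun=> 0) v.
  elim: j => [|j IH] [|i] v //.
    have : (0 < height v)%N by apply/card_gt0P; exists v; rewrite inE connect0.
    by case: (height v).
  move=> hv ji /=; rewrite /gate_step; case: (label v) => //; apply: eq_bigr => e /eqP ev;
    by rewrite IH //; have := height_edge ac e; rewrite ev; lia.
move=> v; rewrite -[RHS]/(iter #|node C|.+1 gate_step (fun=> 0) v).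
by rewrite (stab #|node C| #|node C|.+1) // max_card.
Qed.

End CircuitTheory.

(** * Bi-homogeneity and the classes *)

(* In {mpoly F[k1 + k2]} the first k1 variables have bi-degree (1,0) and the
   last k2 have bi-degree (0,1). *)
Definition bihomogeneous (F : fieldType) (k1 k2 : nat) (f : {mpoly F[k1 + k2]}) : Prop :=
  exists d1 d2 : nat, forall m, m \in msupp f ->
    (\sum_(i < k1) m (lshift k2 i) = d1)%N /\
    (\sum_(j < k2) m (rshift k1 j) = d2)%N.

Definition bihomogeneous_circuit (F : fieldType) (k1 k2 : nat)
    (C : circuit F (k1 + k2)) : Prop :=
  is_circuit C /\ forall v : node C, bihomogeneous (gate_poly v).

Definition zero_set2 (F : fieldType) (k1 k2 : nat) (C : circuit F (k1 + k2))
    (p : proj F k1) (q : proj F k2) : Prop :=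
  forall x y, represents x p -> represents y q ->
  forall v, v \in outputs C -> meval_row (gate_poly v) (row_mx x y) = 0.

(* Sequences are indexed by the positive integers: the entry at index 0 carries
   no meaning and is ignored everywhere. The number of homogeneous coordinates
   [ncoord n] is one more than the dimension of the ambient space. *)
Record proj_seq (F : fieldType) : Type := ProjSeq {
  ncoord : nat -> nat;
  pset : forall n, proj F (ncoord n) -> Prop }.

Record proj_seq2 (F : fieldType) : Type := ProjSeq2 {
  ncoord1 : nat -> nat;
  ncoord2 : nat -> nat;
  pset2 : forall n, proj F (ncoord1 n) -> proj F (ncoord2 n) -> Prop }.

Definition ambient_ok (k : nat -> nat) : Prop :=
  poly_bounded k /\ forall n, (0 < n)%N -> (0 < k n)%N.

Definition P_proj (F : fieldType) (Y : proj_seq2 F) : Prop :=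
  [/\ ambient_ok (ncoord1 Y), ambient_ok (ncoord2 Y) &
   exists C : forall n, circuit F (ncoord1 Y n + ncoord2 Y n),
   [/\ poly_bounded (fun n => circuit_size (C n)),
       poly_bounded (fun n => #|outputs (C n)|),
       poly_bounded (fun n => output_degree (C n)),
       forall n, (0 < n)%N -> bihomogeneous_circuit (C n) &
       forall n, (0 < n)%N -> forall p q, pset2 p q <-> zero_set2 (C n) p q]].

Definition NP_proj (F : fieldType) (X : proj_seq F) : Prop :=
  ambient_ok (ncoord X) /\
  exists (k2 : nat -> nat)
         (Y : forall n, proj F (ncoord X n) -> proj F (k2 n) -> Prop),
    P_proj (ProjSeq2 Y) /\
    forall n, (0 < n)%N -> forall p, pset p <-> exists q, Y n p q.

Definition reduces (F : fieldType) (X Y : proj_seq F) : Prop :=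
  exists (p : nat -> nat)
         (rho : forall n, proj F (ncoord X n) -> proj F (ncoord Y (p n))),
    poly_bounded p /\
    forall n, (0 < n)%N ->
      [/\ (0 < p n)%N, projective_linear (rho n) &
          forall a, pset (rho n a) <-> pset a].

Definition NP_proj_hard (F : fieldType) (X : proj_seq F) : Prop :=
  forall Y : proj_seq F, NP_proj Y -> reduces Y X.

Definition NP_proj_complete (F : fieldType) (X : proj_seq F) : Prop :=
  NP_proj X /\ NP_proj_hard X.

(** * Universal circuits *)

Definition bideg : Type := (nat * nat)%type.

Definition lebd (j l : bideg) : bool := (j.1 <= l.1)%N && (j.2 <= l.2)%N.
Definition subbd (l j : bideg) : bideg := ((l.1 - j.1)%N, (l.2 - j.2)%N).

Section UniversalGates.
Local Open Scope nat_scope.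
Variables (c n m r s : nat).

Definition level : Type := ('I_r.+1 * 'I_r.+1)%type.
Definition bd (l : level) : bideg := (val l.1, val l.2).

(* (R, l, j, i): the i-th product gate of type j in product-level l of Phi^R.
   The conditions on l and j force R != (0,0). *)
Definition is_prod_gate (p : level * level * level * 'I_(c * s)) : bool :=
  let: (R, l, j, _) := p in
  [&& lebd (bd l) (bd R), bd l \notin [:: (0, 0); (1, 0); (0, 1)],
      lebd (bd j) (bd l), bd j != (0, 0) & bd j != bd l].

Definition prod_gate : finType := {p | is_prod_gate p}.

Definition prod_comp (p : prod_gate) : level := (val p).1.1.1.
Definition prod_level (p : prod_gate) : bideg := bd (val p).1.1.2.
Definition prod_type (p : prod_gate) : bideg := bd (val p).1.2.

Definition out_gate : finType := ({R : level | bd R != (0, 0)} * 'I_n)%type.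

(* [inl (p, b)] is the sum gate feeding product gate p, through its first
   (b = false) or second (b = true) input; [inr (R, i)] is the i-th output
   of Phi^R. *)
Definition sum_gate : finType := (prod_gate * bool + out_gate)%type.

Definition sum_comp (g : sum_gate) : level :=
  match g with inl (p, _) => prod_comp p | inr (R, _) => val R end.

Definition sum_level (g : sum_gate) : bideg :=
  match g with
  | inl (p, false) => prod_type p
  | inl (p, true) => subbd (prod_level p) (prod_type p)
  | inr (R, _) => bd (val R)
  end.

Definition input_level (i : 'I_(n + m)) : bideg :=
  match split i with inl _ => (1, 0) | inr _ => (0, 1) end.

Definition in_edge : finType :=
  {e : 'I_(n + m) * sum_gate | sum_level e.2 == input_level e.1}.

Definition prod_edge : finType :=
  {e : prod_gate * sum_gate |
     (prod_comp e.1 == sum_comp e.2) && (prod_level e.1 == sum_level e.2)}.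

Definition univ_node : finType := ('I_(n + m) + sum_gate + prod_gate)%type.
Definition univ_edge : finType := (in_edge + prod_edge + prod_gate * bool)%type.

Definition input_node (i : 'I_(n + m)) : univ_node := inl (inl i).
Definition sum_node (g : sum_gate) : univ_node := inl (inr g).
Definition prod_node (p : prod_gate) : univ_node := inr p.

Definition univ_src (e : univ_edge) : univ_node :=
  match e with
  | inl (inl e) => input_node (val e).1
  | inl (inr e) => prod_node (val e).1
  | inr f => sum_node (inl f)
  end.

Definition univ_tgt (e : univ_edge) : univ_node :=
  match e with
  | inl (inl e) => sum_node (val e).2
  | inl (inr e) => sum_node (val e).2
  | inr f => prod_node f.1
  end.

(* The number N(n,m,r,s) of control variables. *)
Definition nctrl : nat := #|univ_edge|.

Definition univ_circuit (F : fieldType) : circuit F (n + m) :=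
  @Circuit F (n + m) univ_node univ_edge univ_src univ_tgt (fun=> 1%R)
    (fun v => match v with
              | inl (inl i) => InVar i
              | inl (inr _) => SumGate
              | inr _ => ProdGate
              end).

End UniversalGates.

(* Every edge e is replaced by three edges src e -> P_e, t_e -> P_e and
   P_e -> tgt e, where P_e is a product gate and t_e an input gate labelled by
   the fresh variable number k + enum_rank e. *)
Section Controlled.
Variables (F : fieldType) (k : nat) (C : circuit F k).

Definition ctrl_node : finType := (node C + edge C + edge C)%type.
Definition ctrl_edge : finType := (edge C + edge C + edge C)%type.
Definition old_node (v : node C) : ctrl_node := inl (inl v).
Definition mid_node (e : edge C) : ctrl_node := inl (inr e).
Definition var_node (e : edge C) : ctrl_node := inr e.

Definition controlled : circuit F (k + #|edge C|) :=
  @Circuit F (k + #|edge C|) ctrl_node ctrl_edge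
    (fun e => match e with
              | inl (inl e) => old_node (src e)
              | inl (inr e) => var_node e
              | inr e => mid_node e
              end)
    (fun e => match e with
              | inl (inl e) => mid_node e
              | inl (inr e) => mid_node e
              | inr e => old_node (tgt e)
              end)
    (fun=> 1)
    (fun v => match v with
              | inl (inl v) =>
                  match label v with
                  | InVar i => InVar (lshift #|edge C| i)
                  | InConst a => InConst a
                  | SumGate => SumGate
                  | ProdGate => ProdGate
                  end
              | inl (inr e) => ProdGate
              | inr e => InVar (rshift k (enum_rank e))
              end).

Lemma controlled_acyclic : acyclic C -> acyclic controlled.
Proof.
move=> ac; apply: (@acyclic_of_height _ _ controlled
  (fun v : ctrl_node => match v with
            | inl (inl v) => (height v).*2
            | inl (inr e) => (height (src e)).*2.+1
            | inr e => 0
            end)).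
by case=> [[e|e]|e] //=; have := height_edge ac e; lia.
Qed.

Lemma controlled_is_circuit : is_circuit C -> is_circuit controlled.
Proof.
move=> [ac lab]; split; first exact: controlled_acyclic.
case=> [[v|e]|e] /=.
- transitivity (is_input (label v)); first by case: (label v).
  rewrite lab; apply/forallP/forallP => H.
    by case=> [[e|e]|e] //=; apply: contra (H e) => /eqP [->].
  by move=> e; apply: contra (H (inr e)) => /eqP /= ->.
- by apply/esym/negbTE/forallPn; exists (inl (inl e)); rewrite negbK.
- by apply/esym/forallP; case=> [[f|f]|f].
Qed.

End Controlled.

Definition univ_ctrl (c n m r s : nat) (F : fieldType) :
    circuit F (n + m + nctrl c n m r s) :=
  controlled (univ_circuit c n m r s F).

Section UniversalCircuits.
Local Open Scope nat_scope.

Lemma univ_circuit_acyclic (c n m r s : nat) (F : fieldType) :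
  acyclic (univ_circuit c n m r s F).
Proof.
apply: (@acyclic_of_height _ _ (univ_circuit c n m r s F)
  (fun v : univ_node c n m r s => match v with
            | inl (inl _) => 0
            | inl (inr g) => ((sum_level g).1 + (sum_level g).2).*2
            | inr p => ((prod_level p).1 + (prod_level p).2).*2.-1
            end)).
case=> [[[[i g] /= /eqP e]|[[p g] /= /andP [_ /eqP e]]]|[[[[[R l] j] i] P] b]] /=.
- by rewrite e /input_level; case: split.
- rewrite -e; case: p {e} => [[[[R l] j] i] P] /=.
  have /and5P [_ + _ _ _] := P.
  by rewrite /prod_level /bd /= !inE !xpair_eqE; lia.
- have /and5P [_] := P.
  rewrite /prod_level /prod_type /lebd /subbd /bd /= !inE !xpair_eqE.
  by case: b => /=; lia.
Qed.

Lemma univ_circuit_is_circuit (c n m r s : nat) (F : fieldType) :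
  (0 < c)%N -> (0 < n)%N -> (0 < m)%N -> (0 < s)%N ->
  is_circuit (univ_circuit c n m r s F).
Proof.
move=> c0 n0 m0 s0; split; first exact: univ_circuit_acyclic.
case=> [[i|g]|p] /=.
- by apply/esym/forallP; case=> [[f|f]|f].
- apply/esym/negbTE/forallPn.
  have i0 : 'I_(c * s) by exists 0; rewrite muln_gt0 c0.
  have [e|ne0] := eqVneq (sum_level g) (1, 0).
    have P : sum_level g == input_level (lshift m (Ordinal n0)).
      by rewrite e /input_level -[lshift _ _]/(unsplit (inl _)) unsplitK.
    by exists (inl (inl (exist _ (lshift m (Ordinal n0), g) P))); rewrite negbK.
  have [e|ne1] := eqVneq (sum_level g) (0, 1).
    have P : sum_level g == input_level (rshift n (Ordinal m0)).
      by rewrite e /input_level -[rshift _ _]/(unsplit (inr _)) unsplitK.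
    by exists (inl (inl (exist _ (rshift n (Ordinal m0), g) P))); rewrite negbK.
  have [l [ll lR l0]] : exists l : level r,
      [/\ bd l = sum_level g, lebd (bd l) (bd (sum_comp g)) & bd l != (0, 0)].
    case: g {ne0 ne1} => [[[[[[R l] j] i] P] b]|[[R P] i]] /=; last first.
      by exists R; split=> //; rewrite /lebd !leqnn.
    have /and5P [lR _ jl j0 jnl] := P.
    case: b; rewrite /prod_type /prod_level /prod_comp /=; last first.
      exists j; split=> //; move: lR jl; rewrite /lebd => /andP[a1 a2] /andP[b1 b2].
      by rewrite (leq_trans b1) // (leq_trans b2).
    have h1 : (l.1 - j.1 < r.+1)%N by have := ltn_ord l.1; lia.
    have h2 : (l.2 - j.2 < r.+1)%N by have := ltn_ord l.2; lia.
    exists (Ordinal h1, Ordinal h2); split=> //.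
      by move: lR jl; rewrite /lebd /=; lia.
    by move: jl jnl; rewrite /lebd /bd /= !xpair_eqE; lia.
  have [j [jl j0 jnl]] : exists j : level r,
      [/\ lebd (bd j) (bd l), bd j != (0, 0) & bd j != bd l].
    move: ne0 ne1 l0; rewrite -ll /bd /lebd /=.
    case: l {ll lR} => [[[|a] pa] [[|b] pb]] //= ne0 ne1 _.
    + have h : (1 < r.+1)%N by lia.
      exists (ord0, Ordinal h); rewrite /= !xpair_eqE in ne1 *; split=> //; lia.
    + have h : (1 < r.+1)%N by lia.
      exists (Ordinal h, ord0); rewrite /= !xpair_eqE in ne0 *; split=> //; lia.
    + have h : (1 < r.+1)%N by lia.
      by exists (Ordinal h, ord0); rewrite /= !xpair_eqE; split=> //; lia.
  have P : is_prod_gate (sum_comp g, l, j, i0).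
    by rewrite /is_prod_gate lR jl j0 jnl ll !inE (negPf ne0) (negPf ne1) -ll (negPf l0).
  have Q : (sum_comp g == sum_comp g) && (bd l == sum_level g) by rewrite eqxx ll eqxx.
  pose p : prod_gate c r s := exist _ (sum_comp g, l, j, i0) P.
  by exists (inl (inr (exist _ (p, g) Q))); rewrite negbK.
- by apply/esym/negbTE/forallPn; exists (inr (p, true)); rewrite negbK.
Qed.

End UniversalCircuits.

(** * The universal circuit resultant *)

Section Resultant.
Variables (F : fieldType) (c n m r s : nat).

Definition univ_zero_set (p : proj F n) (q : proj F m)
    (w : proj F (nctrl c n m r s)) : Prop :=
  forall x y t, represents x p -> represents y q -> represents t w ->
  forall v, v \in outputs (univ_ctrl c n m r s F) ->
    meval_row (gate_poly v) (row_mx (row_mx x y) t) = 0.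

Definition resultant (p : proj F n) (w : proj F (nctrl c n m r s)) : Prop :=
  exists q : proj F m, univ_zero_set p q w.

End Resultant.

(* The image of S under the Segre embedding ([x_i]_i, [t_j]_j) |-> [x_i t_j]_{i,j}. *)
Definition segre_image (F : fieldType) (k l : nat)
    (S : proj F k -> proj F l -> Prop) (z : proj F (k * l)) : Prop :=
  exists (x : 'rV[F]_k) (t : 'rV[F]_l) (p : proj F k) (w : proj F l),
    [/\ represents x p, represents t w, S p w &
        represents (mxvec (\matrix_(i, j) (x 0 i * t 0 j))) z].

Definition s_param (n m : nat) : nat := (n ^ 2 + n + m)%N.

Definition N_ctrl (c n m : nat) : nat := nctrl c n m n (s_param n m).

Definition R_nm (F : fieldType) (c n m : nat) :
    proj F n -> proj F (N_ctrl c n m) -> Prop :=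
  @resultant F c n m n (s_param n m).

(* Enumeration by diagonals of the pairs of positive integers, starting at
   index 1: (1,1), (1,2), (2,1), (1,3), (2,2), (3,1), ... *)
Definition diag_next (nm : nat * nat) : nat * nat :=
  if (nm.2 <= 1)%N then (1, nm.1.+1)%N else (nm.1.+1, nm.2.-1)%N.

Definition diag_pair (k : nat) : nat * nat := iter k.-1 diag_next (1, 1)%N.

Definition diag_pos (n m : nat) : nat := ('C((n + m).-1, 2) + n)%N.

Lemma diag_pair_gt0 (k : nat) : (0 < (diag_pair k).1)%N && (0 < (diag_pair k).2)%N.
Proof.
rewrite /diag_pair; elim: k.-1 => //= i; rewrite /diag_next.
by case: (iter _ _ _) => a b /=; case: ifP => /=; lia.
Qed.

Lemma diag_pos_next (nm : nat * nat) : (0 < nm.1)%N -> (0 < nm.2)%N ->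
  diag_pos (diag_next nm).1 (diag_next nm).2 = (diag_pos nm.1 nm.2).+1.
Proof.
case: nm => [[|n] [|[|m]]] //= _ _; rewrite /diag_pos /diag_next /=.
  by rewrite !addnS ?addn0 ?add0n /= binS bin1; lia.
by rewrite addSn !addnS.
Qed.

Lemma diag_posK (k : nat) : (0 < k)%N -> diag_pos (diag_pair k).1 (diag_pair k).2 = k.
Proof.
case: k => // k _; elim: k => [|k IH]; first by [].
have /andP [a b] := diag_pair_gt0 k.+1.
by rewrite [diag_pair k.+2]/(diag_next (diag_pair k.+1)) diag_pos_next // IH.
Qed.

Lemma diag_pairK (n m : nat) : (0 < n)%N -> (0 < m)%N ->
  diag_pair (diag_pos n m) = (n, m).
Proof.
have [k] := ubnP (diag_pos n m); elim: k n m => // k IH n m lek n0 m0.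
have step a b : (0 < a)%N -> (0 < b)%N -> diag_next (a, b) = (n, m) ->
    diag_pair (diag_pos n m) = (n, m).
  move=> a0 b0 e; have /= E := @diag_pos_next (a, b) a0 b0; rewrite e /= in E.
  have pos : (0 < diag_pos a b)%N by rewrite /diag_pos; lia.
  rewrite -e -(IH a b) //; last by lia.
  by rewrite E /diag_pair /=; case: (diag_pos a b) pos.
case: n n0 lek step => // -[|n] _ lek step.
  case: m m0 lek step => // -[|m] _ lek step; first by [].
  by apply: (step m.+1 1%N).
by apply: (step n.+1 m.+1); rewrite // /diag_next /= ; case: m m0 {lek step}.
Qed.

Lemma diag_pos_quadratic (n m : nat) : (diag_pos n m <= (n + m) ^ 2)%N.
Proof.
rewrite /diag_pos; case: (n + m)%N (leq_addr m n) => [|k] /=; first by rewrite bin0n; lia.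
by move=> le; have := bin2 k; nia.
Qed.

Definition segre_resultant_seq (F : fieldType) (c : nat) : proj_seq F :=
  @ProjSeq F
    (fun k => (diag_pair k).1 * N_ctrl c (diag_pair k).1 (diag_pair k).2)%N
    (fun k => segre_image (@R_nm F c (diag_pair k).1 (diag_pair k).2)).

(* Main.v *)
(** For hardness, let C be a bi-homogeneous circuit defining a set of pairs
    ([x], [y]). Replacing every product gate of C by a chain of binary products,
    one per incoming edge, writes every nonzero gate of bi-degree l <> (0,0) as
    a linear combination of products of bi-degree l (or of input variables),
    where both factors of each product are again such combinations, of smaller
    bi-degree. This is precisely the shape of the universal circuit: the
    coefficients of the combinations become values t of the control variables,
    and setting the controls of the edges that enter product gates to 1 keeps
    t nonzero. The reduction is [x] |-> Segre([x : 0 : ... : 0], t).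

    For membership, z lies on the Segre variety iff its 2x2 minors vanish, and
    then each row of z is a multiple of t and each column a multiple of x, so
    that, by tri-homogeneity, the outputs of the universal circuit can be
    evaluated on the rows and columns of z. *)
Require Import Defs.
From mathcomp Require Import all_boot all_order all_algebra.
From mathcomp Require Import zify ring.
From mathcomp Require Import mpoly.
From Stdlib Require Import IndefiniteDescription.

Set Implicit Arguments.
Unset Strict Implicit.
Unset Printing Implicit Defensive.

Import GRing.Theory.
Local Open Scope ring_scope.

(** * Polynomially bounded functions *)

Section PolyBounded.
Local Open Scope nat_scope.

Lemma poly_bounded_le (f g : nat -> nat) :
  poly_bounded g -> (forall n, f n <= g n) -> poly_bounded f.
Proof. by move=> [q Q] le_fg; exists q => n; apply: leq_trans (Q n). Qed.

Lemma poly_bounded_const (a : nat) : poly_bounded (fun=> a).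
Proof. by exists (a%:P)%R => n; rewrite hornerC. Qed.

Lemma poly_bounded_id : poly_bounded (fun n => n).
Proof. by exists ('X)%R => n; rewrite hornerX. Qed.

Lemma poly_boundedD (f g : nat -> nat) :
  poly_bounded f -> poly_bounded g -> poly_bounded (fun n => f n + g n).
Proof. by move=> [p P] [q Q]; exists (p + q)%R => n; rewrite hornerD leq_add. Qed.

Lemma poly_boundedM (f g : nat -> nat) :
  poly_bounded f -> poly_bounded g -> poly_bounded (fun n => f n * g n).
Proof. by move=> [p P] [q Q]; exists (p * q)%R => n; rewrite hornerM leq_mul. Qed.

Lemma poly_boundedX (f : nat -> nat) (d : nat) :
  poly_bounded f -> poly_bounded (fun n => f n ^ d).
Proof.
move=> F; elim: d => [|d IH]; first exact: poly_bounded_const 1.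
by apply: poly_bounded_le (poly_boundedM F IH) _ => n; rewrite expnS.
Qed.

End PolyBounded.

(** * Weighted homogeneous polynomials *)

Section WeightedHomogeneous.
Variables (F : fieldType) (k : nat).
Implicit Types (w : 'I_k -> nat) (f g : {mpoly F[k]}) (d : nat).

(** One grading at a time: bi- and tri-homogeneity are handled as several weight functions [w]
    applied to the same polynomial. The zero polynomial has every degree. *)
Definition weighted_homog w d f : Prop :=
  forall m, m \in msupp f -> (\sum_i m i * w i)%N = d.

Lemma weighted_homog0 w d : weighted_homog w d 0.
Proof. by move=> m; rewrite msupp0. Qed.

Lemma weighted_homogC w a : weighted_homog w 0 a%:MP.
Proof.
move=> m; rewrite msuppC; case: eqP => // _; rewrite inE => /eqP ->.
by rewrite big1 // => i _; rewrite mnm0E.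
Qed.

Lemma weighted_homogX w i : weighted_homog w (w i) 'X_i.
Proof.
move=> m; rewrite msuppX inE => /eqP ->; rewrite (bigD1 i) //= big1 ?addn0.
  by rewrite mnm1E eqxx mul1n.
by move=> j ne_ji; rewrite mnm1E eq_sym (negPf ne_ji).
Qed.

Lemma weighted_homogD w d f g :
  weighted_homog w d f -> weighted_homog w d g -> weighted_homog w d (f + g).
Proof. by move=> hf hg m /msuppD_le; rewrite mem_cat => /orP []; [apply: hf | apply: hg]. Qed.

Lemma weighted_homogZ w d a f : weighted_homog w d f -> weighted_homog w d (a *: f).
Proof. by move=> hf m /msuppZ_le; apply: hf. Qed.

Lemma weighted_homogM w d e f g :
  weighted_homog w d f -> weighted_homog w e g -> weighted_homog w (d + e) (f * g).
Proof.
move=> hf hg m /msuppM_le /allpairsP [[m1 m2] /= [/hf <- /hg <- ->]].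
by rewrite -big_split; apply: eq_bigr => i _; rewrite mnmDE mulnDl.
Qed.

Lemma weighted_homog_uniq w d e f :
  f != 0 -> weighted_homog w d f -> weighted_homog w e f -> d = e.
Proof.
rewrite -msupp_eq0; case E: (msupp f) => [|m l] // _ hd he.
by rewrite -(hd m) ?(he m) // E inE eqxx.
Qed.

Lemma weighted_homog_scale w d f (a : F) (x : 'I_k -> F) :
  weighted_homog w d f -> f.@[fun i => a ^+ w i * x i] = a ^+ d * f.@[x].
Proof.
move=> hf; rewrite !mevalE mulr_sumr; apply: eq_big_seq => m /hf <-.
rewrite mulrCA; congr (_ * _).
under eq_bigr => i _ do rewrite exprMn -exprM mulnC.
by rewrite big_split /= -expr_sum.
Qed.

End WeightedHomogeneous.

(** The coercion of a sum to [bool] is true on [inl], so [wt1] and [wt2] are the indicators of the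
    first and second group of variables. *)
Definition wt1 (k1 k2 : nat) (i : 'I_(k1 + k2)) : nat := split i : bool.
Definition wt2 (k1 k2 : nat) (i : 'I_(k1 + k2)) : nat := ~~ (split i : bool).

Lemma split_lshift (k1 k2 : nat) (i : 'I_k1) : split (lshift k2 i) = inl i.
Proof. by rewrite -[lshift _ _]/(unsplit (inl _)) unsplitK. Qed.

Lemma split_rshift (k1 k2 : nat) (i : 'I_k2) : split (rshift k1 i) = inr i.
Proof. by rewrite -[rshift _ _]/(unsplit (inr _)) unsplitK. Qed.

(** * Bi-homogeneous polynomials *)

Section Bihomogeneous.
Variables (F : fieldType) (k1 k2 : nat).
Implicit Types (f g : {mpoly F[k1 + k2]}) (d : bideg).

Definition bihomog_of d f : Prop :=
  weighted_homog (@wt1 k1 k2) d.1 f /\ weighted_homog (@wt2 k1 k2) d.2 f.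

Lemma sum_wt1 (m : 'X_{1..k1 + k2}) :
  (\sum_i m i * wt1 i = \sum_(i < k1) m (lshift k2 i))%N.
Proof.
rewrite big_split_ord /= [X in (_ + X)%N]big1 ?addn0.
  by apply: eq_bigr => i _; rewrite /wt1 split_lshift muln1.
by move=> i _; rewrite /wt1 split_rshift muln0.
Qed.

Lemma sum_wt2 (m : 'X_{1..k1 + k2}) :
  (\sum_i m i * wt2 i = \sum_(i < k2) m (rshift k1 i))%N.
Proof.
rewrite big_split_ord /= [X in (X + _)%N]big1 ?add0n.
  by apply: eq_bigr => i _; rewrite /wt2 split_rshift muln1.
by move=> i _; rewrite /wt2 split_lshift muln0.
Qed.

Lemma bihomogeneousP f : bihomogeneous f <-> exists d, bihomog_of d f.
Proof.
split=> [[d1 [d2 h]]|[[d1 d2] [h1 h2]]].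
  exists (d1, d2); split=> m /h [e1 e2]; first by rewrite sum_wt1.
  by rewrite sum_wt2.
by exists d1, d2 => m mf; rewrite -sum_wt1 -sum_wt2 h1 // h2.
Qed.

Lemma bihomog_mdeg d f m : bihomog_of d f -> m \in msupp f -> mdeg m = (d.1 + d.2)%N.
Proof.
move=> [h1 h2] mf; rewrite -(h1 m mf) -(h2 m mf) sum_wt1 sum_wt2 mdegE.
by rewrite big_split_ord.
Qed.

Lemma bihomog_msize d f : bihomog_of d f -> ((msize f).-1 <= d.1 + d.2)%N.
Proof.
move=> h; suff: (msize f <= (d.1 + d.2).+1)%N by lia.
rewrite msizeE; apply/bigmax_leqP_seq => m mf _.
by rewrite (bihomog_mdeg h mf).
Qed.

Lemma bihomog_deg_le d f : f != 0 -> bihomog_of d f -> (d.1 + d.2 <= (msize f).-1)%N.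
Proof.
rewrite -msupp_eq0; case E: (msupp f) => [|m l] // _ h.
have mf : m \in msupp f by rewrite E inE eqxx.
by have := msize_mdeg_lt mf; rewrite (bihomog_mdeg h mf); lia.
Qed.

Lemma bihomog_uniq d e f : f != 0 -> bihomog_of d f -> bihomog_of e f -> d = e.
Proof.
move=> f0 [h1 h2] [g1 g2]; rewrite (surjective_pairing d) (surjective_pairing e).
by rewrite (weighted_homog_uniq f0 h1 g1) (weighted_homog_uniq f0 h2 g2).
Qed.

Lemma bihomog00 d f : d == (0, 0)%N -> bihomog_of d f -> f = (f@_0)%:MP.
Proof.
move=> /eqP -> h; apply: msize1_polyC.
by have /= := bihomog_msize h; lia.
Qed.

End Bihomogeneous.

(** * Arithmetic circuits *)

Section CircuitDegrees.
Variables (F : fieldType) (k : nat) (C : circuit F k).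

Lemma circuit_ind (P : node C -> Prop) : acyclic C ->
  (forall v, (forall e, tgt e = v -> P (src e)) -> P v) -> forall v, P v.
Proof.
move=> ac step v; have [n] := ubnP (height v); elim: n v => // n IH v hv.
by apply: step => e ev; apply: IH; have := height_edge ac e; rewrite ev; lia.
Qed.

(** A formal degree read off the wiring, defined also at gates that compute 0. Checking it is local,
    and homogeneity of every gate follows by induction along the edges. *)
Definition degree_compat (w : 'I_k -> nat) (d : node C -> nat) : Prop :=
  forall v, match label v with
  | InVar i => d v = w i
  | InConst _ => d v = 0%N
  | SumGate => forall e, tgt e = v -> d (src e) = d v
  | ProdGate => d v = (\sum_(e | tgt e == v) d (src e))%N
  end.

Lemma degree_compat_homog w d : acyclic C -> degree_compat w d ->
  forall v, weighted_homog w (d v) (gate_poly v).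
Proof.
move=> ac dw; apply: (circuit_ind ac) => v IH.
rewrite (gate_polyE ac) /gate_step; move: (dw v).
case: (label v) => [i ->|a ->|dv|->]; [exact: weighted_homogX|exact: weighted_homogC| |].
- apply: big_ind; [exact: weighted_homog0|exact: weighted_homogD|].
  by move=> e /eqP ev; apply: weighted_homogZ; rewrite -(dv e ev); apply: IH.
- apply: (@big_ind2 _ _ (weighted_homog w)); [exact: weighted_homogC| |].
    by move=> d1 f1 d2 f2; apply: weighted_homogM.
  by move=> e /eqP ev; apply: weighted_homogZ; apply: IH.
Qed.

Lemma gate_eval (z : 'I_k -> F) : acyclic C -> forall v : node C,
  (gate_poly v).@[z] =
    match label v with
    | InVar i => z i
    | InConst a => a
    | SumGate => \sum_(e : edge C | tgt e == v) weight e * (gate_poly (src e)).@[z]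
    | ProdGate => \prod_(e | tgt e == v) (weight e * (gate_poly (src e)).@[z])
    end.
Proof.
move=> ac v; rewrite {1}(gate_polyE ac) /gate_step.
case: (label v) => [i|a||]; rewrite ?mevalXU ?mevalC //.
- by rewrite raddf_sum; apply: eq_bigr => e _ /=; rewrite mevalZ.
- by rewrite rmorph_prod; apply: eq_bigr => e _ /=; rewrite mevalZ.
Qed.

End CircuitDegrees.

(** * Disjoint copies and unions of circuits *)

Definition relabel (F : fieldType) (k l : nat) (s : 'I_k -> 'I_l) (g : gate F k) :
    gate F l :=
  match g with
  | InVar i => InVar (s i)
  | InConst a => InConst a
  | SumGate => SumGate
  | ProdGate => ProdGate
  end.

Section Copies.
Variables (F : fieldType) (k l : nat) (I : finType) (s : I -> 'I_k -> 'I_l).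
Variable C : circuit F k.

(** The copies share variables but no gates; each substitution [s i] may identify variables of
    [C]. *)
Definition copies : circuit F l :=
  @Circuit F l (I * node C)%type (I * edge C)%type
    (fun e => (e.1, src e.2)) (fun e => (e.1, tgt e.2)) (fun e => weight e.2)
    (fun v => relabel (s v.1) (label v.2)).

Lemma copies_acyclic : acyclic C -> acyclic copies.
Proof.
move=> ac; apply: (@acyclic_of_height _ _ copies (fun v => height v.2)) => e.
exact: height_edge.
Qed.

Lemma copies_is_circuit : is_circuit C -> is_circuit copies.
Proof.
move=> [ac lab]; split; first exact: copies_acyclic.
case=> i v; transitivity (is_input (label v)); first by rewrite /=; case: (label v).
rewrite lab; apply/forallP/forallP => H.
  by case=> j e; rewrite /= xpair_eqE negb_and H orbT.
by move=> e; have := H (i, e); rewrite /= xpair_eqE eqxx.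
Qed.

Lemma big_copies_tgt (R : Type) (idx : R) (op : Monoid.com_law idx) i v
    (G : edge copies -> R) :
  \big[op/idx]_(e : edge copies | tgt e == (i, v)) G e =
  \big[op/idx]_(e | tgt e == v) G (i, e).
Proof.
transitivity (\big[op/idx]_(e : I * edge C | (e.1 == i) && (tgt e.2 == v)) G (e.1, e.2)).
  by apply: eq_big => [[j e]|[j e] _] //=.
by rewrite -(pair_big (pred1 i) (fun e => tgt e == v) (fun i e => G (i, e))) big_pred1_eq.
Qed.

Lemma copies_eval (z : 'I_l -> F) : acyclic C -> forall i (v : node C),
  (gate_poly ((i, v) : node copies)).@[z] = (gate_poly v).@[z \o s i].
Proof.
move=> ac i; apply: (circuit_ind ac) => v IH.
rewrite (gate_eval _ (copies_acyclic ac)) (gate_eval _ ac) /=.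
case: (label v) => //=; rewrite big_copies_tgt; apply: eq_bigr => e /eqP ev /=;
  by rewrite IH.
Qed.

Lemma copies_degree_compat (w : 'I_l -> nat) (d : I -> node C -> nat) :
  (forall i, degree_compat (w \o s i) (d i)) ->
  @degree_compat F l copies w (fun v => d v.1 v.2).
Proof.
move=> dw [i v]; move: (dw i v) => /=; case: (label v) => //=.
  by move=> H [j e] [-> /= ev]; apply: H.
by move=> ->; rewrite big_copies_tgt.
Qed.

Lemma copies_outputs i (v : node C) :
  ((i, v) \in outputs copies) = (v \in outputs C).
Proof.
rewrite !inE; apply/forallP/forallP => H.
  by move=> e; have := H (i, e); rewrite /= xpair_eqE eqxx.
by case=> j e; rewrite /= xpair_eqE negb_and H orbT.
Qed.

End Copies.

Section Juxtaposition.
Variables (F : fieldType) (k : nat) (A B : circuit F k).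

Definition juxt : circuit F k :=
  @Circuit F k (node A + node B)%type (edge A + edge B)%type
    (fun e => match e with inl e => inl (src e) | inr e => inr (src e) end)
    (fun e => match e with inl e => inl (tgt e) | inr e => inr (tgt e) end)
    (fun e => match e with inl e => weight e | inr e => weight e end)
    (fun v => match v with inl v => label v | inr v => label v end).

Lemma juxt_acyclic : acyclic A -> acyclic B -> acyclic juxt.
Proof.
move=> acA acB; apply: (@acyclic_of_height _ _ juxt
  (fun v => match v with inl v => height v | inr v => height v end)).
by case=> e; apply: height_edge.
Qed.

Lemma juxt_is_circuit : is_circuit A -> is_circuit B -> is_circuit juxt.
Proof.
move=> [acA labA] [acB labB]; split; first exact: juxt_acyclic.
by case=> v /=; rewrite ?labA ?labB; apply/forallP/forallP => H;
  [case|move=> e; apply: (H (inl e))|case|move=> e; apply: (H (inr e))].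
Qed.

Lemma big_juxt_tgtl (R : Type) (idx : R) (op : Monoid.com_law idx) v (G : edge juxt -> R) :
  \big[op/idx]_(e : edge juxt | tgt e == inl v) G e =
  \big[op/idx]_(e | tgt e == v) G (inl e).
Proof. by rewrite big_sumType /= [X in op _ X]big_pred0 ?Monoid.mulm1. Qed.

Lemma big_juxt_tgtr (R : Type) (idx : R) (op : Monoid.com_law idx) v (G : edge juxt -> R) :
  \big[op/idx]_(e : edge juxt | tgt e == inr v) G e =
  \big[op/idx]_(e | tgt e == v) G (inr e).
Proof. by rewrite big_sumType /= [X in op X _]big_pred0 ?Monoid.mul1m. Qed.

Lemma juxt_evall (z : 'I_k -> F) : acyclic A -> acyclic B -> forall v : node A,
  (gate_poly (inl v : node juxt)).@[z] = (gate_poly v).@[z].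
Proof.
move=> acA acB; apply: (circuit_ind acA) => v IH.
rewrite (gate_eval _ (juxt_acyclic acA acB)) (gate_eval _ acA) /=.
case: (label v) => //=; rewrite big_juxt_tgtl; apply: eq_bigr => e /eqP ev /=;
  by rewrite IH.
Qed.

Lemma juxt_evalr (z : 'I_k -> F) : acyclic A -> acyclic B -> forall v : node B,
  (gate_poly (inr v : node juxt)).@[z] = (gate_poly v).@[z].
Proof.
move=> acA acB; apply: (circuit_ind acB) => v IH.
rewrite (gate_eval _ (juxt_acyclic acA acB)) (gate_eval _ acB) /=.
case: (label v) => //=; rewrite big_juxt_tgtr; apply: eq_bigr => e /eqP ev /=;
  by rewrite IH.
Qed.

Lemma juxt_degree_compat (w : 'I_k -> nat) (dA : node A -> nat) (dB : node B -> nat) :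
  degree_compat w dA -> degree_compat w dB ->
  @degree_compat F k juxt w (fun v => match v with inl v => dA v | inr v => dB v end).
Proof.
move=> hA hB [v|v]; [move: (hA v)|move: (hB v)]; rewrite /=; case: (label v) => //=.
- by move=> H [e|e] // [ev]; apply: H.
- by rewrite big_juxt_tgtl.
- by move=> H [e|e] // [ev]; apply: H.
- by rewrite big_juxt_tgtr.
Qed.

Lemma juxt_outputs (v : node juxt) : (v \in outputs juxt) =
  match v with inl v => v \in outputs A | inr v => v \in outputs B end.
Proof.
by case: v => v; rewrite !inE; apply/forallP/forallP => H;
  [move=> e; apply: (H (inl e))|case|move=> e; apply: (H (inr e))|case].
Qed.

End Juxtaposition.

(** * The 2x2 minor as a circuit *)

Section Minor.
Variable F : fieldType.

(** The determinant X_0 X_3 - X_1 X_2: product gate [false] multiplies X_0 and X_3, product gate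
    [true] multiplies X_1 and X_2 and enters the sum with weight -1. *)
Definition minor_circuit : circuit F 4 :=
  @Circuit F 4 ((bool * bool) + bool + unit)%type ((bool * bool) + bool)%type
    (fun e => match e with inl e => inl (inl e) | inr b => inl (inr b) end)
    (fun e => match e with inl e => inl (inr e.1) | inr b => inr tt end)
    (fun e => match e with inr true => -1 | _ => 1 end)
    (fun v => match v with
       | inl (inl (false, b)) => InVar (if b then inord 3 else inord 0)
       | inl (inl (true, b)) => InVar (if b then inord 2 else inord 1)
       | inl (inr _) => ProdGate
       | inr _ => SumGate
       end).

Lemma minor_acyclic : acyclic minor_circuit.
Proof.
apply: (@acyclic_of_height _ _ minor_circuit
  (fun v => match v with inl (inl _) => 0 | inl (inr _) => 1 | inr _ => 2 end)%N).
by case.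
Qed.

Lemma minor_is_circuit : is_circuit minor_circuit.
Proof.
split; first exact: minor_acyclic.
case=> [[[[] []]|b]|[]] /=; try by apply/esym/forallP; case.
  by apply/esym/negbTE/forallPn; exists (inl (b, true)); rewrite negbK.
by apply/esym/negbTE/forallPn; exists (inr true); rewrite negbK.
Qed.

Lemma big_minor_tgt (R : Type) (idx : R) (op : Monoid.com_law idx) b
    (G : edge minor_circuit -> R) :
  \big[op/idx]_(e : edge minor_circuit | tgt e == inl (inr b)) G e =
  op (G (inl (b, true))) (G (inl (b, false))).
Proof.
rewrite big_sumType /= [X in op _ X]big_pred0 ?Monoid.mulm1 //.
under eq_bigl => e do rewrite -[_ == _]/(e.1 == b).
rewrite (eq_bigl (fun e : bool * bool => (e.1 == b) && true)); last by move=> e; rewrite andbT.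
rewrite (eq_bigr (fun e : bool * bool => G (inl (e.1, e.2)))); last by case.
rewrite -(pair_big (pred1 b) predT (fun b c => G (inl (b, c)))) big_pred1_eq.
by rewrite big_bool.
Qed.

Lemma minor_eval (z : 'I_4 -> F) :
  (gate_poly (inr tt : node minor_circuit)).@[z] =
    z (inord 0) * z (inord 3) - z (inord 1) * z (inord 2).
Proof.
have ac := minor_acyclic; rewrite (gate_eval _ ac) /=.
rewrite big_sumType /= big_pred0 // add0r big_bool /=.
rewrite !(gate_eval z ac (inl (inr _))) /= !big_minor_tgt.
by rewrite !(gate_eval z ac (inl (inl _))) /=; ring.
Qed.

Lemma minor_outputs v : v \in outputs minor_circuit -> v = inr tt.
Proof.
rewrite inE => /forallP; case: v => [[e|b]|[]] // H.
  by have := H (inl e); rewrite eqxx.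
by have := H (inr b); rewrite eqxx.
Qed.

Definition minor_degree (d : nat) (v : node minor_circuit) : nat :=
  match v with inl (inl _) => d | _ => d.*2 end.

Lemma minor_degree_compat (d : nat) (w : 'I_4 -> nat) : (forall i, w i = d) ->
  degree_compat w (minor_degree d).
Proof.
move=> wd [[[[] b]|b]|[]] /=; rewrite ?wd //; last by case.
by rewrite big_minor_tgt /= addnn.
Qed.

End Minor.

(** * Evaluation and degrees of circuits with control variables *)

Section ControlledCircuits.
Variables (F : fieldType) (k : nat) (C : circuit F k).
Hypothesis ac : acyclic C.

Let acc := controlled_acyclic ac.

Lemma big_controlled_old (R : Type) (idx : R) (op : Monoid.com_law idx) v
    (G : edge (controlled C) -> R) :
  \big[op/idx]_(e : edge (controlled C) | tgt e == old_node v) G e =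
  \big[op/idx]_(e | tgt e == v) G (inr e).
Proof.
rewrite big_sumType /= big_pred0 ?Monoid.mul1m; first by apply: eq_bigl.
by case.
Qed.

Lemma big_controlled_mid (R : Type) (idx : R) (op : Monoid.com_law idx) e
    (G : edge (controlled C) -> R) :
  \big[op/idx]_(f : edge (controlled C) | tgt f == mid_node e) G f =
  op (G (inl (inl e))) (G (inl (inr e))).
Proof.
rewrite big_sumType /= [X in op _ X]big_pred0 ?Monoid.mulm1 //.
by rewrite big_sumType /=; congr (op _ _); apply: (big_pred1 e).
Qed.

(** Once the control variables have values, these values play the part of the edge weights of [C];
    the middle gates disappear from the recursion. *)
Lemma controlled_eval (z : 'I_(k + #|edge C|) -> F) (v : node C) :
  let E v := (gate_poly (old_node v : node (controlled C))).@[z] in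
  let t e := z (rshift k (enum_rank e)) in
  E v = match label v with
        | InVar i => z (lshift _ i)
        | InConst a => a
        | SumGate => \sum_(e | tgt e == v) E (src e) * t e
        | ProdGate => \prod_(e | tgt e == v) (E (src e) * t e)
        end.
Proof.
have mid e : (gate_poly (mid_node e : node (controlled C))).@[z] =
    (gate_poly (old_node (src e) : node (controlled C))).@[z] *
    z (rshift k (enum_rank e)).
  rewrite (gate_eval z acc (mid_node e)) /= big_controlled_mid /= !mul1r.
  by rewrite (gate_eval z acc (var_node e)).
rewrite /= (gate_eval z acc (old_node v)) /=.
by case: (label v) => //=; rewrite big_controlled_old /=; apply: eq_bigr => e _;
  rewrite mul1r mid.
Qed.

Definition controlled_degree (c : nat) (d : node C -> nat) (v : node (controlled C)) : nat :=
  match v with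
  | inl (inl v) => d v
  | inl (inr e) => (d (src e) + c)%N
  | inr _ => c
  end.

(** Here [c] is the weight of a control variable, so crossing an edge raises the degree by [c]: it
    is 0 for the x- and y-gradings and 1 for the t-grading. *)
Lemma controlled_degree_compat (w : 'I_(k + #|edge C|) -> nat) (c : nat) (d : node C -> nat) :
  (forall j, w (rshift k j) = c) ->
  (forall v, match label v with
     | InVar i => d v = w (lshift _ i)
     | InConst _ => d v = 0%N
     | SumGate => forall e, tgt e = v -> (d (src e) + c)%N = d v
     | ProdGate => d v = (\sum_(e | tgt e == v) (d (src e) + c))%N
     end) ->
  degree_compat w (controlled_degree c d).
Proof.
move=> wc H [[v|e]|e] /=.
- move: (H v); case: (label v) => //=; last by rewrite big_controlled_old.
  by move=> {}H [[e|e]|e] // [ev]; apply: H.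
- by rewrite big_controlled_mid.
- by rewrite wc.
Qed.

End ControlledCircuits.

(** * The universal circuit *)

Lemma big_sig_cond (R : Type) (idx : R) (op : Monoid.com_law idx) (T : finType)
    (P Q : pred T) (G : T -> R) :
  \big[op/idx]_(x : {x | P x} | Q (val x)) G (val x) =
  \big[op/idx]_(x | P x && Q x) G x.
Proof.
rewrite [RHS](reindex_omap (val : {x | P x} -> T) insub); last first.
  by move=> i /andP [Pi _]; rewrite insubT.
by apply: eq_bigl => x; rewrite valK (valP x) eqxx andbT.
Qed.

Section Universal.
Variables (c n m r s : nat) (F : fieldType).

Local Notation U := (univ_circuit c n m r s F).
Local Notation sum_gate := (sum_gate c n r s).
Local Notation prod_gate := (prod_gate c r s).
Local Notation acU := (@univ_circuit_acyclic c n m r s F).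

Lemma big_univ_sum (R : Type) (idx : R) (op : Monoid.com_law idx) (g : sum_gate)
    (G : edge U -> R) :
  \big[op/idx]_(e : edge U | tgt e == sum_node m g) G e =
  op (\big[op/idx]_(e : in_edge c n m r s | (val e).2 == g) G (inl (inl e)))
     (\big[op/idx]_(e : prod_edge c n r s | (val e).2 == g) G (inl (inr e))).
Proof.
by rewrite !big_sumType /= [X in op _ X]big_pred0 ?Monoid.mulm1.
Qed.

Lemma big_univ_prod (R : Type) (idx : R) (op : Monoid.com_law idx) (p : prod_gate)
    (G : edge U -> R) :
  \big[op/idx]_(e : edge U | tgt e == prod_node n m p) G e =
  op (G (inr (p, true))) (G (inr (p, false))).
Proof.
rewrite !big_sumType /= [X in op (op X _) _]big_pred0 // [X in op (op _ X) _]big_pred0 //.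
rewrite !Monoid.mul1m.
transitivity (\big[op/idx]_(e : prod_gate * bool | (e.1 == p) && true) G (inr (e.1, e.2))).
  by apply: eq_big => [e|[]] //; rewrite andbT.
rewrite -(pair_big (pred1 p) predT (fun p b => G (inr (p, b)))) big_pred1_eq.
by rewrite big_bool.
Qed.

Lemma sum_level_le (g : sum_gate) : lebd (sum_level g) (bd (sum_comp g)).
Proof.
case: g => [[[[[[R l] j] i] P] b]|[[R P] i]]; last by rewrite /lebd /= !leqnn.
have /and5P [h1 _ h2 _ _] := P; move: h1 h2; rewrite /lebd /bd /=.
by case: b; rewrite /= /prod_type /prod_level /prod_comp /subbd /bd /=; lia.
Qed.

Lemma sum_level_le_r (g : sum_gate) : ((sum_level g).1 <= r)%N /\ ((sum_level g).2 <= r)%N.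
Proof.
have /andP [h1 h2] := sum_level_le g.
have := ltn_ord (sum_comp g).1; have := ltn_ord (sum_comp g).2.
by move: h1 h2; rewrite /bd /=; lia.
Qed.

Lemma prod_levelP (p : prod_gate) :
  [/\ (prod_type p).1 <= (prod_level p).1, (prod_type p).2 <= (prod_level p).2,
      0 < (prod_type p).1 + (prod_type p).2,
      (prod_type p).1 + (prod_type p).2 < (prod_level p).1 + (prod_level p).2 &
      1 < (prod_level p).1 + (prod_level p).2]%N.
Proof.
case: p => [[[[R l] j] i] P]; have /and5P [] := P.
by rewrite /prod_type /prod_level /lebd /bd /= !inE !xpair_eqE; split; lia.
Qed.

Definition bideg_total (d : bideg) : nat := (d.1 + d.2)%N.

Section Weights.
Variable phi : bideg -> nat.

(** Taking [fst] or [snd] for the additive map [phi] gives the x-degree or the y-degree. *)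
Definition univ_degree (v : node U) : nat :=
  match v with
  | inl (inl i) => phi (input_level i)
  | inl (inr g) => phi (sum_level g)
  | inr p => phi (prod_level p)
  end.

Lemma univ_degree_compat (w : 'I_(n + m + #|edge U|) -> nat) :
  {morph phi : d e / (d.1 + e.1, d.2 + e.2)%N >-> (d + e)%N} ->
  (forall j, w (rshift _ j) = 0%N) ->
  (forall i, w (lshift _ i) = phi (input_level i)) ->
  degree_compat w (@controlled_degree F _ U 0 univ_degree).
Proof.
move=> phiD w0 wi; apply: controlled_degree_compat => // -[[i|g]|p] /=.
- by rewrite wi.
- by case=> [[[[i h] /= /eqP lv]|[[p h] /= /andP [_ /eqP lv]]]|e] // [<-]; rewrite addn0 ?lv.
- have [h1 h2 _ _ _] := prod_levelP p.
  by rewrite big_univ_prod /= !addn0 -phiD !subnK // -surjective_pairing.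
Qed.

End Weights.

(* All parse trees below a sum gate of level l have |l| leaves and 4|l| - 3
   edges. *)
Definition univ_ctrl_degree (v : node U) : nat :=
  match v with
  | inl (inl _) => 0
  | inl (inr g) => (4 * bideg_total (sum_level g) - 3)%N
  | inr p => (4 * bideg_total (prod_level p) - 4)%N
  end.

Lemma input_level_total (i : 'I_(n + m)) : bideg_total (input_level i) = 1%N.
Proof. by rewrite /input_level; case: split. Qed.

Lemma univ_ctrl_degree_compat (w : 'I_(n + m + #|edge U|) -> nat) :
  (forall j, w (rshift _ j) = 1%N) -> (forall i, w (lshift _ i) = 0%N) ->
  degree_compat w (@controlled_degree F _ U 1 univ_ctrl_degree).
Proof.
move=> w1 w0; apply: controlled_degree_compat => // -[[i|g]|p] /=.
- by rewrite w0.
- case=> [[[[i h] /= /eqP lv]|[[p h] /= /andP [_ /eqP lv]]]|e] // [<-].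
    by rewrite lv input_level_total.
  by have [_ _ _ _] := prod_levelP p; rewrite -lv /bideg_total; lia.
- rewrite big_univ_prod /= /bideg_total /subbd /=.
  by have [] := prod_levelP p; rewrite /prod_level /prod_type /bd /=; lia.
Qed.

Lemma univ_level_le (v : node U) : (0 < r)%N ->
  (univ_degree fst v <= r /\ univ_degree snd v <= r /\ univ_ctrl_degree v <= 8 * r)%N.
Proof.
(* A level has total degree at most 2r, and the control degree is below four times that total. *)
move=> r0; case: v => [[i|g]|p] /=; rewrite /bideg_total.
- by rewrite /input_level; case: split => /=; lia.
- by have [] := sum_level_le_r g; lia.
- have := ltn_ord (val p).1.1.2.1; have := ltn_ord (val p).1.1.2.2.
  by rewrite /prod_level /bd /=; lia.
Qed.

Definition out_node (o : out_gate n r) : node (univ_ctrl c n m r s F) :=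
  @old_node F _ U (sum_node m (inr o : sum_gate)).

(** Every other gate is used. An input feeds an output of Phi^(1,0) or Phi^(0,1), which exist as r >
    0; a sum gate feeds its own product gate; a product gate of level l in Phi^R feeds an output if
    l = R, and otherwise a sum gate of level l below a product gate of level R and type l. *)
Lemma univ_ctrl_output (v : node (univ_ctrl c n m r s F)) : (0 < r)%N -> (0 < n)%N ->
  v \in outputs (univ_ctrl c n m r s F) ->
  exists o, v = out_node o.
Proof.
move=> r0 n0; rewrite inE => /forallP; case: v => [[v|e]|e] H; last first.
- by have := H (inl (inr e)); rewrite eqxx.
- by have := H (inr e); rewrite eqxx.
suff: (exists o, v = sum_node m (inr o : sum_gate)) \/ exists e : edge U, src e = v.
  case=> [[o ->]|[e ev]]; first by exists o.
  by have := H (inl (inl e)); rewrite -ev /= eqxx.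
case: v {H} => [[i|[[p b]|o]]|p].
- right.
  have [R lR] : exists R : {R : level r | bd R != (0, 0)%N}, bd (val R) = input_level i.
    have lt1 : (1 < r.+1)%N by [].
    rewrite /input_level; case: split => _.
      by exists (exist _ (Ordinal lt1, ord0) isT).
    by exists (exist _ (ord0, Ordinal lt1) isT).
  have P : sum_level (inr (R, Ordinal n0) : sum_gate) == input_level i by rewrite /= lR.
  by exists (inl (inl (exist _ (i, inr (R, Ordinal n0)) P))).
- by right; exists (inr (p, b)).
- by left; exists o.
- right; case: p => [[[[R l] j] i] P].
  have /and5P [lR l0 jl j0 jl'] := P.
  have lz : bd l != (0, 0)%N by move: l0; rewrite !inE; case: eqP.
  have [eRl|neRl] := eqVneq (bd R) (bd l).
    have Rz : bd R != (0, 0)%N by rewrite eRl.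
    have Q : (R == R) && (bd l == bd R) by rewrite eRl !eqxx.
    by exists (inl (inr (exist _ (exist _ (R, l, j, i) P : prod_gate,
                                  inr (exist _ R Rz, Ordinal n0)) Q))).
  have Q : is_prod_gate (R, R, l, i).
    apply/and5P; split=> //; last by rewrite eq_sym.
      by rewrite /lebd !leqnn.
    move: l0 lR lz neRl; rewrite /lebd /bd !inE !xpair_eqE /=; lia.
  pose g : sum_gate := inl (exist _ (R, R, l, i) Q : prod_gate, false).
  have Q' : (R == R) && (bd l == bd l) by rewrite !eqxx.
  by exists (inl (inr (exist _ (exist _ (R, l, j, i) P : prod_gate, g) Q'))).
Qed.

Lemma out_gate_output (o : out_gate n r) :
  out_node o \in outputs (univ_ctrl c n m r s F).
Proof.
rewrite inE; apply/forallP; case=> [[[[e|e]|e]|e]|e] //; try by apply/eqP.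
Qed.

End Universal.

(** * Straight-line programs of bi-homogeneous products *)

Definition addbd (d e : bideg) : bideg := ((d.1 + e.1)%N, (d.2 + e.2)%N).

Section Programs.
Variables (F : fieldType) (k1 k2 : nat).
Local Notation poly := {mpoly F[k1 + k2]}.

(* (l, j, P): a product P of level l and type j. *)
Definition instr : eqType := (bideg * bideg * poly)%type.

(** What a sum gate of sum-level [l] can compute when the product gates below it hold the products
    in [ps]. *)
Inductive spanned (ps : seq instr) (l : bideg) : poly -> Prop :=
| spanned0 : spanned ps l 0
| spannedX i : input_level i = l -> spanned ps l 'X_i
| spannedP x : x \in ps -> x.1.1 = l -> spanned ps l x.2
| spannedD f g : spanned ps l f -> spanned ps l g -> spanned ps l (f + g)
| spannedZ a f : spanned ps l f -> spanned ps l (a *: f).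

Lemma spanned_sub (ps qs : seq instr) l f :
  {subset ps <= qs} -> spanned ps l f -> spanned qs l f.
Proof.
move=> sub; elim=> [|i il|x /sub xq xl|{}f g _ hf _ hg|a {}f _ hf].
- exact: spanned0.
- exact: spannedX.
- exact: spannedP.
- exact: spannedD.
- exact: spannedZ.
Qed.

(** The factors may refer to any entry of the list; there is no circularity, because both have
    bi-degree strictly below that of their product. *)
Definition program (ps : seq instr) : Prop := forall x, x \in ps ->
  [/\ lebd x.1.2 x.1.1, x.1.2 != (0, 0)%N, x.1.2 != x.1.1 &
   exists f g, [/\ x.2 = f * g, spanned ps x.1.2 f & spanned ps (subbd x.1.1 x.1.2) g]].

Lemma program_rcons (ps : seq instr) d e f g :
  program ps -> d != (0, 0)%N -> e != (0, 0)%N -> spanned ps d f -> spanned ps e g ->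
  program (rcons ps (addbd d e, d, f * g)).
Proof.
move=> pps d0 e0 df eg x.
have sub : {subset ps <= rcons ps (addbd d e, d, f * g)}.
  by move=> y y_in; rewrite mem_rcons inE y_in orbT.
rewrite mem_rcons inE => /orP [/eqP ->|/pps [h1 h2 h3 [A [B [e1 hA hB]]]]]; last first.
  by split=> //; exists A, B; split=> //; apply: spanned_sub sub _.
split=> //=; first by rewrite /lebd /= !leq_addr.
  by move: e0; rewrite /addbd; case: (d) (e) => [d1 d2] [e1 e2]; rewrite !xpair_eqE /=; lia.
exists f, g; split=> //; first exact: spanned_sub sub _.
have -> : subbd (addbd d e) d = e by rewrite /subbd /addbd /= !addKn -surjective_pairing.
exact: spanned_sub sub _.
Qed.

Lemma bihomog_ofM d e (f g : poly) :
  bihomog_of d f -> bihomog_of e g -> bihomog_of (addbd d e) (f * g).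
Proof. by move=> [f1 f2] [g1 g2]; split; apply: weighted_homogM. Qed.

Lemma bihomog_ofX (i : 'I_(k1 + k2)) : bihomog_of (input_level i) ('X_i : poly).
Proof.
rewrite /bihomog_of; have [-> ->] : (input_level i).1 = wt1 i /\ (input_level i).2 = wt2 i.
  by rewrite /input_level /wt1 /wt2; case: split.
by split; apply: weighted_homogX.
Qed.

(* Multiplying the factors one after the other takes one product per factor;
   factors of degree (0,0) are scalars. *)
Lemma program_prod (I : Type) (es : seq I) (d : I -> bideg) (f : I -> poly) (ps : seq instr) :
  program ps ->
  (forall e, bihomog_of (d e) (f e)) ->
  (forall e, d e != (0, 0)%N -> spanned ps (d e) (f e)) ->
  exists qs D, [/\ program (ps ++ qs), (size qs <= size es)%N,
    bihomog_of D (\prod_(e <- es) f e) &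
    D != (0, 0)%N -> spanned (ps ++ qs) D (\prod_(e <- es) f e)].
Proof.
move=> pps hom sp; elim: es => [|e es [qs [D [pqs sz hD spD]]]].
  exists [::], (0, 0)%N; rewrite cats0 big_nil; split=> //.
  by split; apply: weighted_homogC.
have sub : {subset ps <= ps ++ qs} by move=> x; rewrite mem_cat => ->.
rewrite big_cons; have hDe := bihomog_ofM (hom e) hD.
have [de0|de0] := eqVneq (d e) (0, 0)%N.
  have hE : addbd (d e) D = D by rewrite de0; case: (D).
  rewrite hE in hDe; exists qs, D; split=> //; first exact: leqW.
  have /eqP /bihomog00 /(_ (hom e)) -> := de0.
  by move=> /spD; rewrite mul_mpolyC; apply: spannedZ.
have [D0|D0] := eqVneq D (0, 0)%N.
  have hE : addbd (d e) D = d e by rewrite D0 /addbd /= !addn0 -surjective_pairing.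
  rewrite hE in hDe; exists qs, (d e); split=> //; first exact: leqW.
  have /eqP /bihomog00 /(_ hD) -> := D0.
  by move=> /sp h; rewrite mulrC mul_mpolyC; apply: spannedZ; apply: spanned_sub sub h.
exists (rcons qs (addbd (d e) D, d e, f e * \prod_(j <- es) f j)), (addbd (d e) D).
rewrite -rcons_cat size_rcons; split=> //.
  by apply: program_rcons => //; [apply: spanned_sub sub _; apply: sp | apply: spD].
move=> _; set x : instr := (_, _, _).
by apply: (@spannedP _ _ x); rewrite // mem_rcons inE eqxx.
Qed.

Section OfCircuit.
Variables (C : circuit F (k1 + k2)) (d : node C -> bideg).
Hypothesis ac : acyclic C.
Hypothesis hom : forall v, bihomog_of (d v) (gate_poly v).

Definition in_edges (v : node C) : {set edge C} := [set e | tgt e == v].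

Lemma bihomog_ofZ l a (f : poly) : bihomog_of l f -> bihomog_of l (a *: f).
Proof. by move=> [f1 f2]; split; apply: weighted_homogZ. Qed.

(** At most one new product per incoming edge: this is what bounds the length of the program by the
    circuit size. The claim concerns nonzero gates, since the value of [d] at a gate computing 0 is
    arbitrary. *)
Lemma spanned_gate (ps : seq instr) v :
  program ps ->
  (forall e, tgt e = v -> gate_poly (src e) != 0 -> d (src e) != (0, 0)%N ->
     spanned ps (d (src e)) (gate_poly (src e))) ->
  exists qs, [/\ program (ps ++ qs), (size qs <= #|in_edges v|)%N &
    gate_poly v != 0 -> d v != (0, 0)%N -> spanned (ps ++ qs) (d v) (gate_poly v)].
Proof.
move=> pps IH; have [fv0|fv0] := eqVneq (gate_poly v) 0.
  by exists [::]; rewrite cats0.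
have := gate_polyE ac v; rewrite /gate_step.
case E: (label v) => [i|a||] fvE.
- exists [::]; rewrite cats0; split=> // _ _; rewrite fvE.
  by apply: spannedX; apply: (bihomog_uniq fv0) => //; rewrite fvE; apply: bihomog_ofX.
- exists [::]; rewrite cats0; split=> // _ /eqP []; apply: (bihomog_uniq fv0) => //.
  by rewrite fvE; split; apply: weighted_homogC.
- exists [::]; rewrite cats0; split=> // _ dv0.
  (* The terms of a degree other than that of the sum cancel. *)
  have {}fvE : gate_poly v = \sum_(e | (tgt e == v) && (d (src e) == d v))
      weight e *: gate_poly (src e).
    apply/mpolyP => mo; rewrite [in LHS]fvE !raddf_sum big_mkcondr /=.
    have coef0 (u : node C) : (\sum_i mo i * wt1 i, \sum_i mo i * wt2 i)%N != d u ->
        (gate_poly u)@_mo = 0.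
      move=> ne; apply: memN_msupp_eq0; apply: contra ne => um.
      have [h1 h2] := hom u.
      by rewrite (h1 _ um) (h2 _ um) -surjective_pairing.
    have [dm|dm] := eqVneq (\sum_i mo i * wt1 i, \sum_i mo i * wt2 i)%N (d v).
      apply: eq_bigr => e /eqP ev; case: eqP => // /eqP ne.
      by rewrite mcoeffZ coef0 ?mulr0 // dm eq_sym.
    transitivity (0 : F).
      by have := coef0 v dm; rewrite fvE raddf_sum.
    rewrite big1 // => e _; case: eqP => // de.
    by rewrite mcoeffZ coef0 ?mulr0 // de.
  rewrite fvE; apply: big_ind; [exact: spanned0|exact: spannedD|].
  move=> e /andP [/eqP ev /eqP de]; apply: spannedZ.
  have [->|nz] := eqVneq (gate_poly (src e)) 0; first exact: spanned0.
  by rewrite -de; apply: IH; rewrite // de.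
- have nz e : tgt e == v -> gate_poly (src e) != 0.
    move=> ev; apply: contraNneq fv0 => z.
    by rewrite fvE (bigD1 e) //= z scaler0 mul0r.
  (* [program_prod] asks for its hypotheses on all edges, so those not entering [v] receive the
     factor 1 of bi-degree (0,0). *)
  pose f e := if tgt e == v then weight e *: gate_poly (src e) else 1.
  pose de e := if tgt e == v then d (src e) else (0, 0)%N.
  have [|e|qs [D [pqs sz hD spD]]] := @program_prod _ (enum (in_edges v)) de f ps pps.
  + move=> e; rewrite /f /de; case: (tgt e =P v) => _; first exact: bihomog_ofZ.
    by split; apply: weighted_homogC.
  + rewrite /f /de; case: (tgt e =P v) => // ev d0; apply: spannedZ.
    by apply: IH => //; apply: nz; apply/eqP.
  have fE : gate_poly v = \prod_(e <- enum (in_edges v)) f e.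
    rewrite fvE big_enum; apply: eq_big => [e|e ev]; first by rewrite inE.
    by rewrite /f ev.
  rewrite -fE in hD spD; exists qs; split=> //; first by rewrite cardE.
  by rewrite (bihomog_uniq fv0 (hom v) hD).
Qed.

(** Induction on the size of [V], removing a gate of maximal height: no other gate of [V] depends on
    it, so the rest is still closed under predecessors. The edges entering the removed gate pay for
    its new products. *)
Lemma program_of_closed_set (V : {set node C}) :
  (forall e, tgt e \in V -> src e \in V) ->
  exists ps, [/\ program ps, (size ps <= #|[set e | tgt e \in V]|)%N &
    forall v, v \in V -> gate_poly v != 0 -> d v != (0, 0)%N ->
      spanned ps (d v) (gate_poly v)].
Proof.
have [n] := ubnP #|V|; elim: n V => // n IH V ltVn closed.
have [->|[v0 v0V]] := set_0Vmem V.
  by exists [::]; split=> // v; rewrite inE.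
case: (arg_maxnP (@height _ _ C) v0V) => v vV' vmax.
have {vV'} vV : v \in V := vV'.
have [||ps [pps sz sp]] := IH (V :\ v).
- by rewrite (cardsD1 v V) vV in ltVn; lia.
- move=> e; rewrite !inE => /andP [_ eV]; rewrite closed // andbT.
  apply: contraTneq (height_edge ac e) => ->.
  by rewrite -leqNgt; apply: vmax.
have [//|e ev nz d0|qs [pqs szq spv]] := @spanned_gate ps v.
  apply: sp => //; rewrite !inE closed ?ev // andbT.
  by apply: contraTneq (height_edge ac e) => {1}->; rewrite ev ltnn.
exists (ps ++ qs); split=> //.
  rewrite size_cat.
  have -> : [set e | tgt e \in V] = [set e | tgt e \in V :\ v] :|: in_edges v.
    by apply/setP => e; rewrite !inE; have [->|] := eqVneq (tgt e) v; rewrite ?vV ?orbF.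
  rewrite cardsU; have -> : [set e | tgt e \in V :\ v] :&: in_edges v = set0.
    by apply/setP => e; rewrite !inE; have [->|] := eqVneq (tgt e) v; rewrite ?andbF.
  by rewrite cards0 subn0 leq_add.
move=> u uV nz d0; have [uv|ne] := eqVneq u v; first by rewrite uv in nz d0 *; apply: spv.
apply: (@spanned_sub ps); first by move=> x; rewrite mem_cat => ->.
by apply: sp; rewrite // !inE ne.
Qed.

Lemma program_of_circuit :
  exists ps, [/\ program ps, (size ps <= #|edge C|)%N &
    forall v : node C, gate_poly v != 0 -> d v != (0, 0)%N ->
      spanned ps (d v) (gate_poly v)].
Proof.
have [|ps [pps sz sp]] := @program_of_closed_set setT.
  by move=> e; rewrite !inE.
exists ps; split=> //; first exact: leq_trans sz (max_card _).
by move=> v; apply: sp; rewrite inE.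
Qed.

End OfCircuit.
End Programs.

(** * Running a program on the universal circuit *)

Lemma big_pair_snd (R : Type) (idx : R) (op : Monoid.com_law idx) (I J : finType)
    (Q : pred (I * J)) (j : J) (G : I * J -> R) :
  \big[op/idx]_(e | Q e && (e.2 == j)) G e = \big[op/idx]_(i | Q (i, j)) G (i, j).
Proof.
transitivity (\big[op/idx]_(e : I * J | Q (e.1, j) && (e.2 == j)) G (e.1, j)).
  apply: eq_big => [[i l]|[i l] /andP [_ /eqP /= ->]] //=.
  by case: (l =P j) => [->|]; rewrite ?andbF.
rewrite -(pair_big (fun i => Q (i, j)) (pred1 j) (fun i _ => G (i, j))).
by apply: eq_bigr => i _; rewrite big_pred1_eq.
Qed.

Section Coefficients.
Variables (F : fieldType) (k1 k2 : nat).
Local Notation poly := {mpoly F[k1 + k2]}.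

Definition instr0 : instr F k1 k2 := ((0, 0)%N, (0, 0)%N, 0).

(** Explicit coefficients, indexed by variables and by positions in [ps]: they will be the control
    values of the edges entering a sum gate. A repeated instruction is charged to its first
    occurrence. *)
Lemma spanned_coef (ps : seq (instr F k1 k2)) l (f : poly) : spanned ps l f ->
  exists ab : ('I_(k1 + k2) -> F) * (nat -> F),
  f = \sum_(i | input_level i == l) ab.1 i *: 'X_i +
      \sum_(k < size ps | (nth instr0 ps k).1.1 == l) ab.2 k *: (nth instr0 ps k).2.
Proof.
elim=> [|i il|x xp xl|{}f g _ [[a b] fE] _ [[a' b'] gE]|e {}f _ [[a b] fE]].
- exists (fun=> 0, fun=> 0); rewrite !big1 ?addr0 // => i _; exact: scale0r.
- exists (fun j => (j == i)%:R, fun=> 0) => /=.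
  rewrite (bigD1 i) ?il //= eqxx scale1r !big1 ?addr0 //; first by move=> k _; rewrite scale0r.
  by move=> j /andP [_ /negPf ->]; rewrite scale0r.
- have lt_x : (index x ps < size ps)%N by rewrite index_mem.
  exists (fun=> 0, fun k => (k == index x ps)%:R) => /=.
  rewrite [X in X + _]big1 ?add0r; last by move=> k _; rewrite scale0r.
  rewrite (bigD1 (Ordinal lt_x)) /= ?nth_index ?xl // eqxx scale1r big1 ?addr0 //.
  move=> k /andP [_ ne]; have /negPf -> : val k != index x ps by [].
  by rewrite scale0r.
- exists (fun i => a i + a' i, fun k => b k + b' k) => /=.
  rewrite fE gE addrACA -!big_split /=.
  by congr (_ + _); apply: eq_bigr => i _; rewrite scalerDl.
- exists (fun i => e * a i, fun k => e * b k) => /=.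
  rewrite fE scalerDr !scaler_sumr.
  by congr (_ + _); apply: eq_bigr => i _; rewrite scalerA.
Qed.

End Coefficients.

Section Simulation.
Variables (c n m r s : nat) (F : fieldType) (k1 k2 : nat).
Variables (sigma : 'I_(k1 + k2) -> 'I_(n + m)).
Hypothesis sigma_level : forall i, input_level (sigma i) = input_level i.
Variables (ps : seq (instr F k1 k2)).
Hypotheses (pps : program ps) (szps : (size ps <= c * s)%N).

Local Notation poly := {mpoly F[k1 + k2]}.
Local Notation U := (univ_circuit c n m r s F).
Local Notation sum_gate := (sum_gate c n r s).
Local Notation prod_gate := (prod_gate c r s).
Local Notation ins k := (nth (@instr0 F k1 k2) ps k).

Definition level_of (d : bideg) : level r := (inord d.1, inord d.2).

Lemma level_ofK (d : bideg) : (d.1 <= r)%N -> (d.2 <= r)%N -> bd (level_of d) = d.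
Proof. by case: d => d1 d2 /= h1 h2; rewrite /bd /= !inordK. Qed.

Lemma bdK (l : level r) : level_of (bd l) = l.
Proof. by case: l => l1 l2; rewrite /level_of /= !inord_val. Qed.

(* The product gate p simulates the instruction with its own index. *)
Definition active (p : prod_gate) : bool :=
  ((val p).2 < size ps)%N && ((ins (val p).2).1 == (prod_level p, prod_type p)).

(** Within the component of [g], each instruction of the level of [g] has exactly one active product
    gate: the level and type are prescribed by the instruction, and its index is available because
    [size ps] is at most [c * s]. *)
Lemma big_active (R : Type) (idx : R) (op : Monoid.com_law idx) (g : sum_gate)
    (G : nat -> R) :
  \big[op/idx]_(k < size ps | (ins k).1.1 == sum_level g) G k =
  \big[op/idx]_(p : prod_gate | [&& prod_comp p == sum_comp g,
      prod_level p == sum_level g & active p]) G (val p).2.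
Proof.
have [gr1 gr2] := sum_level_le_r g.
rewrite (big_ord_widen_cond _ (fun k => (ins k).1.1 == sum_level g) G szps).
pose q (k : 'I_(c * s)) := (sum_comp g, level_of (sum_level g), level_of (ins k).1.2, k).
rewrite (reindex_omap (fun p : prod_gate => (val p).2) (fun k => insub (q k))) /=; last first.
  move=> k /andP [/eqP lk ltk].
  suff Q : is_prod_gate (q k) by rewrite insubT.
  have [le_jl j0 jl _] := pps (mem_nth (@instr0 F k1 k2) ltk).
  have /andP [h1 h2] := le_jl; rewrite lk in h1 h2.
  rewrite /q /is_prod_gate !level_ofK ?(leq_trans h1) ?(leq_trans h2) //.
  rewrite sum_level_le j0 -lk jl le_jl /= !andbT.
  move: h1 h2 j0 jl; rewrite lk; case: (ins k) => [[l [j1 j2]] P] /=.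
  by case: (sum_level g) => l1 l2 /=; rewrite !inE !xpair_eqE; lia.
apply: eq_bigl => p; apply/andP/and3P.
  case=> [/andP [/eqP lp ltp]]; case: insubP => // u _ uE /eqP [up].
  have vp : val p = q (val p).2 by rewrite -{1}up uE.
  have [h1 h2 _ _ _] := prod_levelP p.
  have lvl : prod_level p = sum_level g by rewrite /prod_level vp /= level_ofK.
  rewrite lvl in h1 h2.
  split; [by rewrite /prod_comp vp|by rewrite lvl|rewrite /active ltp /=].
  have le_jl := pps (mem_nth (@instr0 F k1 k2) ltp).
  have [/andP [j1 j2] _ _ _] := le_jl; rewrite lp in j1 j2.
  have -> : prod_type p = (ins (val p).2).1.2.
    by rewrite /prod_type [in LHS]vp /= level_ofK ?(leq_trans j1) ?(leq_trans j2).
  by rewrite lvl -lp -surjective_pairing.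
case=> /eqP cp /eqP lp /andP [ltp /eqP ip].
rewrite ip ltp /= lp eqxx; split=> //.
have vp : q (val p).2 = val p.
  rewrite /q ip -cp -lp /prod_level /prod_type /prod_comp !bdK /=.
  by case: (val p) => [[[]]].
by rewrite vp valK.
Qed.

(** Chooses targets for the two sum gates feeding [p]: at an active gate the two factors of its
    instruction, otherwise 0. Thus every sum gate has a target in the span of its level. *)
Lemma factorization (p : prod_gate) : exists AB : bool -> poly,
  (forall b, spanned ps (sum_level (inl (p, b) : sum_gate)) (AB b)) /\
  (active p -> (ins (val p).2).2 = AB false * AB true).
Proof.
case ap: (active p); last first.
  by exists (fun=> 0); split=> // b; exact: spanned0.
have /andP [ltp /eqP ip] := ap.
have [_ _ _ [A [B [e hA hB]]]] := pps (mem_nth (@instr0 F k1 k2) ltp).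
rewrite ip /= in hA hB.
by exists (fun b : bool => if b then B else A); split=> // -[].
Qed.

(** The controls are chosen before the point [z], so one [t] serves all points. Since fan-out is at
    most 1, each sum gate owns its incoming edges and its coefficients can be set independently of
    the other gates. *)
Lemma simulation (f : out_gate n r -> poly) :
  (forall o, spanned ps (bd (val o.1)) (f o)) ->
  exists t : edge U -> F, (forall e, t (inr e) = 1) /\
  forall (z : 'I_(n + m) -> F) (E : node U -> F),
    (forall v, E v = match label v with
       | InVar i => z i
       | InConst a => a
       | SumGate => \sum_(e | tgt e == v) E (src e) * t e
       | ProdGate => \prod_(e | tgt e == v) (E (src e) * t e)
       end) ->
    forall o, E (sum_node m (inr o : sum_gate)) = (f o).@[z \o sigma].
Proof.
move=> hf; have [AB hAB] := fin_all_exists factorization.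
pose H (g : sum_gate) : poly := match g with inl pb => AB pb.1 pb.2 | inr o => f o end.
have hH g : spanned ps (sum_level g) (H g).
  by case: g => [[p b]|[R i]]; [have [] := hAB p | apply: hf (R, i)].
have /fin_all_exists [ab Hab] g := spanned_coef (hH g).
(* An edge from an input carries the total coefficient of the variables sent to that input; an edge
   from a product gate carries the coefficient of its instruction, or 0 if inactive; edges into
   product gates carry 1. *)
exists (fun e : edge U => match e with
  | inl (inl e) => \sum_(i | sigma i == (val e).1) (ab (val e).2).1 i
  | inl (inr e) => if active (val e).1 then (ab (val e).2).2 (val (val e).1).2 else 0
  | inr _ => 1
  end); split=> // z E recE.
suff EH g : E (sum_node m g) = (H g).@[z \o sigma] by move=> o; apply: EH.
(* Induction on the total degree of the level: both sum gates below an active product gate lie in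
   smaller levels. *)
have [N] := ubnP (bideg_total (sum_level g)); elim: N g => // N IH g ltgN.
have Eprod p : prod_level p = sum_level g -> active p ->
    E (prod_node n m p) = (ins (val p).2).2.@[z \o sigma].
  move=> pg ap; have [h1 h2 h3 h4 _] := prod_levelP p.
  have [_ /(_ ap) ->] := hAB p; rewrite recE /= (@big_univ_prod c n m r s F) /= !mulr1 mevalM mulrC.
  congr (_ * _).
    by apply: (IH (inl (p, false))); move: ltgN h1 h2 h3 h4;
      rewrite -pg /bideg_total /prod_level /prod_type /=; lia.
  by apply: (IH (inl (p, true))); move: ltgN h1 h2 h3 h4;
    rewrite -pg /bideg_total /prod_level /prod_type /=; lia.
rewrite recE /= (@big_univ_sum c n m r s F) /= [in RHS]Hab mevalD; congr (_ + _).
  rewrite (big_sig_cond _ (fun e : 'I_(n + m) * sum_gate => sum_level e.2 == input_level e.1)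
    (fun e => e.2 == g) (fun e => E (@input_node c n m r s e.1) *
       \sum_(i | sigma i == e.1) (ab e.2).1 i)).
  rewrite big_pair_snd /= raddf_sum /=.
  (* The program variables are grouped by the universal input to which [sigma] sends them. *)
  rewrite [RHS](partition_big sigma (fun i => sum_level g == input_level i)) /=; last first.
    by move=> i /eqP <-; rewrite sigma_level.
  apply: eq_bigr => i /eqP gi; rewrite recE /= mulr_sumr.
  apply: eq_big => [j|j /eqP <-]; last by rewrite mevalZ mevalXU mulrC.
  by case: eqP => [ji|]; rewrite ?andbF // -sigma_level ji gi eqxx.
rewrite (big_sig_cond _ (fun e : prod_gate * sum_gate =>
    (prod_comp e.1 == sum_comp e.2) && (prod_level e.1 == sum_level e.2))
  (fun e => e.2 == g) (fun e => E (prod_node n m e.1) *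
     (if active e.1 then (ab e.2).2 (val e.1).2 else 0))).
rewrite big_pair_snd /= raddf_sum /=.
(* Instructions are exchanged for active product gates; the inactive ones compute uncontrolled
   values, but their edges into [g] carry 0. *)
rewrite (big_active _ g (fun k => ((ab g).2 k *: (ins k).2).@[z \o sigma])).
rewrite [RHS](eq_bigl (fun p =>
    (prod_comp p == sum_comp g) && (prod_level p == sum_level g) && active p));
  last by move=> p; rewrite andbA.
rewrite [RHS]big_mkcondr /=; apply: eq_bigr => p /andP [_ /eqP pg].
by case: ifP => ap; rewrite ?mulr0 // Eprod // mevalZ mulrC.
Qed.

End Simulation.

(** * Points of projective space *)

Section Points.
Variable F : fieldType.

Lemma representsZ (k : nat) (v : 'rV[F]_k) p a :
  a != 0 -> represents v p -> represents (a *: v) p.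
Proof.
by move=> a0 /andP [v0 vp]; rewrite /represents scaler_eq0 negb_or a0 v0 memvZ.
Qed.

Lemma represents_proportional (k : nat) (v w : 'rV[F]_k) p :
  represents v p -> represents w p -> exists2 a, a != 0 & w = a *: v.
Proof.
rewrite represents_line => /andP [v0 /eqP vp] /andP [w0].
rewrite vp => /vlineP [a wE]; exists a => //.
by apply: contraNneq w0 => a0; rewrite wE a0 scale0r.
Qed.

Lemma represents_inj (k : nat) (v : 'rV[F]_k) p q :
  represents v p -> represents v q -> p = q.
Proof.
rewrite !represents_line => /andP [_ /eqP vp] /andP [_ /eqP vq].
by apply: val_inj; rewrite /= vp vq.
Qed.

Lemma row_neq0 (k : nat) (v : 'rV[F]_k) : v != 0 -> exists i, v 0 i != 0.
Proof. by case/matrix0Pn => i [j]; rewrite ord1; exists j. Qed.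

Definition segre (k l : nat) (x : 'rV[F]_k) (t : 'rV[F]_l) : 'rV[F]_(k * l) :=
  mxvec (\matrix_(i, j) (x 0 i * t 0 j)).

Lemma segreE (k l : nat) (x : 'rV[F]_k) (t : 'rV[F]_l) i j :
  segre x t 0 (mxvec_index i j) = x 0 i * t 0 j.
Proof. by rewrite mxvecE mxE. Qed.

Lemma segre_eq0 (k l : nat) (x : 'rV[F]_k) (t : 'rV[F]_l) :
  x != 0 -> t != 0 -> segre x t != 0.
Proof.
move=> /row_neq0 [i xi] /row_neq0 [j tj]; apply/eqP => /rowP /(_ (mxvec_index i j)).
by rewrite segreE mxE => /eqP; rewrite mulf_eq0 (negPf xi) (negPf tj).
Qed.

(** Injectivity of the Segre embedding: a column with nonzero t_j recovers x up to a scalar, and a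
    row with nonzero x_i recovers t. *)
Lemma segre_proportional (k l : nat) (x x' : 'rV[F]_k) (t t' : 'rV[F]_l) a :
  x != 0 -> t != 0 -> segre x t = a *: segre x' t' ->
  (exists2 b, b != 0 & x = b *: x') /\ (exists2 b, b != 0 & t = b *: t').
Proof.
move=> x0 t0 /rowP E.
have {}E i j : x 0 i * t 0 j = a * (x' 0 i * t' 0 j).
  by have := E (mxvec_index i j); rewrite [in RHS]mxE !segreE.
have [i xi] := row_neq0 x0; have [j tj] := row_neq0 t0; split.
  have xE : x = (a * t' 0 j / t 0 j) *: x'.
    by apply/rowP => u; rewrite mxE; apply: (mulIf tj); rewrite E; field.
  exists (a * t' 0 j / t 0 j) => //.
  by apply: contraNneq x0 => b0; rewrite xE b0 scale0r.
have tE : t = (a * x' 0 i / x 0 i) *: t'.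
  by apply/rowP => u; rewrite mxE; apply: (mulfI xi); rewrite E; field.
exists (a * x' 0 i / x 0 i) => //.
by apply: contraNneq t0 => b0; rewrite tE b0 scale0r.
Qed.

(** With [t] fixed, the Segre map is linear in x; this matrix makes the reduction
    projective-linear. *)
Definition segre_mx (k l : nat) (t : 'rV[F]_l) : 'M[F]_(k, k * l) :=
  \matrix_(i, e) segre (delta_mx 0 i) t 0 e.

Lemma mul_segre_mx (k l : nat) (x : 'rV[F]_k) (t : 'rV[F]_l) :
  x *m segre_mx k t = segre x t.
Proof.
apply/rowP => e; case/mxvec_indexP: e => i j; rewrite segreE mxE (bigD1 i) //=.
rewrite big1 ?addr0; last first.
  by move=> u ne; rewrite mxE segreE mxE /= eq_sym (negPf ne) mul0r mulr0.
by rewrite mxE segreE mxE !eqxx mul1r.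
Qed.

Lemma segre_imageP (k l : nat) (S : proj F k -> proj F l -> Prop) x t p w z :
  represents x p -> represents t w -> represents (segre x t) z ->
  segre_image S z <-> S p w.
Proof.
move=> xp tw xtz; split=> [[x' [t' [p' [w' [xp' tw' Spw z']]]]]|Spw]; last first.
  by exists x, t, p, w.
have [a a0 E] := represents_proportional z' xtz.
have [x0 _] := andP xp; have [t0 _] := andP tw.
have [[b b0 xE] [e e0 tE]] := segre_proportional x0 t0 E.
have -> : p = p' by apply: represents_inj xp _; rewrite xE; apply: representsZ.
by have -> : w = w' by apply: represents_inj tw _; rewrite tE; apply: representsZ.
Qed.

End Points.

(** * Homogeneity of the universal circuit *)

Section UniversalHomogeneity.
Variables (c n m r s : nat) (F : fieldType).
Local Notation U := (univ_circuit c n m r s F).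
Local Notation UC := (univ_ctrl c n m r s F).
Local Notation N := (nctrl c n m r s).

Definition ctrl_weight (phi : bideg -> nat) (i : 'I_(n + m + N)) : nat :=
  match split i with inl j => phi (input_level j) | inr _ => 0 end.

Lemma univ_ctrl_acyclic : acyclic UC.
Proof. exact/controlled_acyclic/univ_circuit_acyclic. Qed.

Lemma ctrl_weight_compat phi :
  {morph phi : d e / (d.1 + e.1, d.2 + e.2)%N >-> (d + e)%N} ->
  @degree_compat F _ UC (ctrl_weight phi)
    (@controlled_degree F _ U 0 (@univ_degree c n m r s F phi)).
Proof.
move=> phiD; apply: univ_degree_compat => // i.
  by rewrite /ctrl_weight split_rshift.
by rewrite /ctrl_weight split_lshift.
Qed.

Lemma ctrl_weight_compat_t :
  @degree_compat F _ UC (@wt2 (n + m) N)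
    (@controlled_degree F _ U 1 (@univ_ctrl_degree c n m r s F)).
Proof.
apply: univ_ctrl_degree_compat => i; first by rewrite /wt2 split_rshift.
by rewrite /wt2 split_lshift.
Qed.

(** Tri-homogeneity, from the three gradings in turn. The scalars may be 0, which matters for
    membership, where rows and columns of z can vanish. *)
Lemma univ_ctrl_scale (v : node UC) (x : 'rV[F]_n) (y : 'rV[F]_m) (t : 'rV[F]_N) a b e :
  meval_row (gate_poly v) (row_mx (row_mx x y) t) = 0 ->
  meval_row (gate_poly v) (row_mx (row_mx (a *: x) (b *: y)) (e *: t)) = 0.
Proof.
move=> E0; rewrite /meval_row.
set z := fun i => _.
have zE : z =1 (fun i => a ^+ ctrl_weight fst i * (b ^+ ctrl_weight snd i *
    (e ^+ wt2 i * row_mx (row_mx x y) t 0 i))).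
  move=> i; rewrite /z /ctrl_weight /wt2 /input_level.
  rewrite -[i]splitK; case: (split i) => [j|j]; rewrite /= ?split_lshift ?split_rshift.
    rewrite !row_mxEl -[j]splitK; case: (split j) => l;
      rewrite /= ?split_lshift ?split_rshift ?row_mxEl ?row_mxEr mxE /=; ring.
  by rewrite !row_mxEr mxE /=; ring.
have ac := univ_ctrl_acyclic; rewrite (meval_eq _ zE).
have h1 := @degree_compat_homog _ _ _ _ _ ac (@ctrl_weight_compat fst (fun _ _ => erefl)) v.
have h2 := @degree_compat_homog _ _ _ _ _ ac (@ctrl_weight_compat snd (fun _ _ => erefl)) v.
have h3 := @degree_compat_homog _ _ _ _ _ ac ctrl_weight_compat_t v.
rewrite (weighted_homog_scale _ _ h1) (weighted_homog_scale _ _ h2) (weighted_homog_scale _ _ h3).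
by rewrite -/(meval_row _ _) E0 !mulr0.
Qed.

(** By scaling, a single choice of representatives decides membership. *)
Lemma univ_zero_setP p q w x y t : (0 < r)%N -> (0 < n)%N ->
  represents x p -> represents y q -> represents t w ->
  @univ_zero_set F c n m r s p q w <->
  forall o, meval_row (gate_poly (out_node c m s F o : node UC))
    (row_mx (row_mx x y) t) = 0.
Proof.
move=> r0 n0 xp yq tw; split=> [Z o|Z x' y' t' xp' yq' tw' v].
  exact: (Z x y t xp yq tw _ (out_gate_output c m s F o)).
move=> /(univ_ctrl_output r0 n0) [o ->].
have [a _ ->] := represents_proportional xp xp'.
have [b _ ->] := represents_proportional yq yq'.
have [e _ ->] := represents_proportional tw tw'.
exact: univ_ctrl_scale.
Qed.

End UniversalHomogeneity.

(** * Hardness *)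

Section Hardness.
Variables (c : nat) (F : fieldType) (a b n : nat) (C : circuit F (a + b)).
Hypotheses (c0 : (0 < c)%N) (hC : bihomogeneous_circuit C).
Hypotheses (le_an : (a <= n)%N) (n2 : (2 <= n)%N).
Hypotheses (le_size : (circuit_size C <= n)%N).
Hypotheses (le_out : (#|outputs C| <= n)%N) (le_deg : (output_degree C <= n)%N).

Local Notation s := (s_param n b).
Local Notation UC := (univ_ctrl c n b n s F).

Definition pad_var (i : 'I_(a + b)) : 'I_(n + b) :=
  match split i with
  | inl j => lshift b (widen_ord le_an j)
  | inr j => rshift n j
  end.

Lemma pad_var_level i : input_level (pad_var i) = input_level i.
Proof.
by rewrite /pad_var /input_level; case: (split i) => j; rewrite ?split_lshift ?split_rshift.
Qed.

Definition pad (v : 'rV[F]_a) : 'rV[F]_n := v *m pid_mx a.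

Lemma padE (v : 'rV[F]_a) (j : 'I_a) : pad v 0 (widen_ord le_an j) = v 0 j.
Proof.
rewrite mxE (bigD1 j) //= big1 ?addr0 => [|i ne].
  by rewrite mxE /= eqxx ltn_ord mulr1.
by rewrite mxE /= -[_ == _ :> nat]/(i == j) (negPf ne) mulr0.
Qed.

Lemma padZ d (v : 'rV[F]_a) : pad (d *: v) = d *: pad v.
Proof. by rewrite /pad scalemxAl. Qed.

Lemma pad_neq0 (v : 'rV[F]_a) : v != 0 -> pad v != 0.
Proof.
move=> /row_neq0 [j vj]; apply/eqP => /rowP /(_ (widen_ord le_an j)).
by rewrite padE mxE => /eqP; rewrite (negPf vj).
Qed.

Lemma row_mx_pad (v : 'rV[F]_a) (y : 'rV[F]_b) i :
  row_mx (pad v) y 0 (pad_var i) = row_mx v y 0 i.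
Proof.
rewrite /pad_var -{2}[i]splitK; case: (split i) => j /=; last by rewrite !row_mxEr.
by rewrite !row_mxEl padE.
Qed.

Lemma exists_gate_degrees : exists d : node C -> bideg, forall v, bihomog_of (d v) (gate_poly v).
Proof.
have [_ hom] := hC.
have homP v : exists d, bihomog_of d (gate_poly (v : node C)) by apply/bihomogeneousP; apply: hom.
exact: fin_all_exists homP.
Qed.

(* Values of the output gates of the universal circuit that cut out the zero
   set of C. A nonzero constant among the outputs of C is replaced by the
   forms X_1, ..., X_a, which have no common zero either. *)
Lemma exists_out_polys (ps : seq (instr F a b)) (d : node C -> bideg) :
  (forall v, bihomog_of (d v) (gate_poly v)) ->
  (forall v : node C, gate_poly v != 0 -> d v != (0, 0)%N ->
     spanned ps (d v) (gate_poly v)) ->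
  exists f : out_gate n n -> {mpoly F[a + b]},
    (forall o, spanned ps (bd (val o.1)) (f o)) /\
    forall (v : 'rV[F]_a) (y : 'rV[F]_b), v != 0 ->
      (forall o, meval_row (f o) (row_mx v y) = 0) <->
      (forall u, u \in outputs C -> meval_row (gate_poly u) (row_mx v y) = 0).
Proof.
move=> hom sp.
have [/existsP [u /and3P [uo nz /eqP du]]|nobad] :=
  boolP [exists u : node C, [&& u \in outputs C, gate_poly u != 0 & d u == (0, 0)%N]].
  exists (fun o => if bd (val o.1) == (1, 0)%N then
      if insub (val o.2) is Some i then 'X_(lshift b i) else 0 else 0); split.
    move=> o; case: eqP => [->|_]; last exact: spanned0.
    case: insub => [i|]; last exact: spanned0.
    by apply: (@spannedX F a b ps _ (lshift b i)); rewrite /input_level split_lshift.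
  move=> v y v0; split=> [Z|/(_ u uo)].
    have [j /eqP []] := row_neq0 v0.
    have lt1 : (1 < n.+1)%N by lia.
    have R0 : bd ((Ordinal lt1, ord0) : level n) != (0, 0)%N by [].
    have := Z (exist _ (Ordinal lt1, ord0) R0, widen_ord le_an j).
    by rewrite /= insubT // => lt_j; rewrite /meval_row mevalXU row_mxEl; congr (_ = _);
      congr (v _ _); apply: val_inj.
  move: nz; have /eqP /bihomog00 /(_ (hom u)) -> := du.
  by rewrite mpolyC_eq0 /meval_row mevalC => /eqP.
(* Output k of Phi^R is to compute the k-th output of [C] if that has bi-degree R, and 0 otherwise;
   the default entry covers k beyond the last output. *)
pose gs := [seq (d u, gate_poly u) | u <- enum (outputs C)].
pose g k := nth ((0, 0)%N, 0) gs k.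
exists (fun o => if (g (val o.2)).1 == bd (val o.1) then (g (val o.2)).2 else 0).
have gP k : (g k).2 = 0 \/ exists2 u, u \in outputs C & g k = (d u, gate_poly u).
  have [lt_k|ge_k] := ltnP k (size gs); last by left; rewrite /g nth_default.
  have /mapP [u] := mem_nth ((0, 0)%N, 0 : {mpoly F[a + b]}) lt_k.
  by rewrite mem_enum => uo gE; right; exists u.
split=> [[R i]|v y v0] /=.
  case: eqP => [gR|_]; last exact: spanned0.
  have [->|[u uo gE]] := gP i; first exact: spanned0.
  rewrite gE /= in gR *; have [->|nz] := eqVneq (gate_poly u) 0; first exact: spanned0.
  by rewrite -gR; apply: sp; rewrite // gR; apply: valP R.
split=> [Z u uo|Z [R i] /=].
  have [->|nz] := eqVneq (gate_poly u) 0; first by rewrite /meval_row meval0.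
  have du0 : d u != (0, 0)%N.
    apply: contraNneq nobad => du; apply/existsP; exists u.
    by rewrite uo nz du eqxx.
  (* The degree bound on [C] ensures that the component Phi^(d u) exists for r = n. *)
  have dun : ((d u).1 + (d u).2 <= n)%N.
    apply: leq_trans le_deg; apply: leq_trans (bihomog_deg_le nz (hom u)) _.
    by rewrite /output_degree (bigD1 u) //= leq_maxl.
  have R0 : bd (level_of n (d u)) != (0, 0)%N by rewrite level_ofK //; lia.
  have lt_k : (index u (enum (outputs C)) < #|outputs C|)%N.
    by rewrite cardE index_mem mem_enum.
  have := Z (exist _ (level_of n (d u)) R0, Ordinal (leq_trans lt_k le_out)).
  rewrite /= level_ofK; try lia.
  rewrite /g (nth_map u) -?cardE // nth_index ?mem_enum //=.
  by rewrite eqxx.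
case: eqP => _; last by rewrite /meval_row meval0.
have [->|[u uo ->]] := gP i; first by rewrite /meval_row meval0.
exact: Z.
Qed.

Lemma exists_control : exists t : 'rV[F]_(N_ctrl c n b), t != 0 /\
  forall v y, v != 0 ->
    (forall o, meval_row (gate_poly (out_node c b s F o : node UC))
       (row_mx (row_mx (pad v) y) t) = 0) <->
    (forall u, u \in outputs C -> meval_row (gate_poly u) (row_mx v y) = 0).
Proof.
have [d hom] := exists_gate_degrees; have [[acC _] _] := hC.
have [ps [pps szps sp]] := program_of_circuit acC hom.
have [f [fsp fP]] := exists_out_polys hom sp.
have le_s : (size ps <= c * s)%N.
  apply: leq_trans szps (leq_trans le_size _).
  by apply: leq_trans (leq_pmull _ c0); rewrite /s_param; lia.
have [t [t1 simul]] := @simulation c n b n s F a b pad_var pad_var_level ps pps le_s f fsp.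
pose tv : 'rV[F]_(N_ctrl c n b) := \row_j t (enum_val j).
exists tv; split.
  (* As n >= 2, there is a product gate of level (2,0) and type (1,0); an edge entering it has
     control 1, so [tv] is nonzero. *)
  have lt2 : (2 < n.+1)%N by lia.
  have lt1 : (1 < n.+1)%N by lia.
  have i0 : 'I_(c * s).
    by exists 0%N; rewrite muln_gt0 c0 /s_param; lia.
  pose R : level n := (Ordinal lt2, ord0); pose j : level n := (Ordinal lt1, ord0).
  have P : is_prod_gate (R, R, j, i0) by [].
  pose p : prod_gate c n s := exist _ (R, R, j, i0) P.
  pose e : univ_edge c n b n s := inr (p, true).
  apply/eqP => /rowP /(_ (enum_rank e)); rewrite !mxE enum_rankK t1.
  by move/eqP; rewrite oner_eq0.
move=> v y v0; rewrite -fP //.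
suff E o : meval_row (gate_poly (out_node c b s F o : node UC))
    (row_mx (row_mx (pad v) y) tv) = meval_row (f o) (row_mx v y).
  by split=> H o; have := H o; rewrite E.
pose z i := row_mx (row_mx (pad v) y) tv 0 i.
pose E v := (gate_poly (@old_node F _ (univ_circuit c n b n s F) v : node UC)).@[z].
rewrite -[LHS]/(E (sum_node b (inr o : sum_gate c n n s))).
rewrite (simul (fun i => row_mx (pad v) y 0 i)).
  by apply: meval_eq => i; apply: row_mx_pad.
have zt e : z (rshift _ (enum_rank e)) = t e by rewrite /z row_mxEr mxE enum_rankK.
move=> u; rewrite /E (controlled_eval (@univ_circuit_acyclic c n b n s F)).
case: (label u) => [i|//||]; first by rewrite /z row_mxEl.
  by apply: eq_bigr => e _; rewrite zt.
by apply: eq_bigr => e _; rewrite zt.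
Qed.

Lemma segre_resultant_reduction :
  exists rho : proj F a -> proj F (n * N_ctrl c n b), projective_linear rho /\
    forall p, segre_image (@R_nm F c n b) (rho p) <-> exists q, zero_set2 C p q.
Proof.
have [t [t0 tP]] := exists_control; have [w tw] := represents_exists_point t0.
pose A := pid_mx a *m segre_mx n t : 'M[F]_(a, n * N_ctrl c n b).
have AE v : v *m A = segre (pad v) t by rewrite /A mulmxA mul_segre_mx.
(* All representatives of [p] have proportional images, nonzero because padding and the Segre map
   preserve nonzero vectors; choice turns this into a function on points. *)
have rhoP p : {z : proj F (n * N_ctrl c n b) | forall v, represents v p -> represents (v *m A) z}.
  apply: constructive_indefinite_description.
  have [v vp] := represents_ex p; have [v0 _] := andP vp.
  have [z zv] : exists z, represents (v *m A) z.
    by apply: represents_exists_point; rewrite AE segre_eq0 ?pad_neq0.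
  exists z => v' v'p; have [e e0 ->] := represents_proportional vp v'p.
  by rewrite -scalemxAl representsZ.
exists (fun p => sval (rhoP p)); split; first by right; exists A => p; apply: svalP (rhoP p).
move=> p; have [v vp] := represents_ex p; have [v0 _] := andP vp.
have [p' p'v] := represents_exists_point (pad_neq0 v0).
have padP x : represents x p -> represents (pad x) p'.
  by move=> xp; have [e e0 ->] := represents_proportional vp xp; rewrite padZ representsZ.
have zv : represents (segre (pad v) t) (sval (rhoP p)) by rewrite -AE; apply: (svalP (rhoP p)).
rewrite (segre_imageP _ p'v tw zv); split=> -[q Z]; exists q.
  move=> x y xp yq u uo; have [x0 _] := andP xp.
  move: u uo; apply/(tP _ _ x0)/univ_zero_setP;
    [lia|lia|exact: padP xp|exact: yq|exact: tw|exact: Z].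
have [y yq] := represents_ex q.
apply/(@univ_zero_setP _ _ _ _ _ _ _ _ _ (pad v) y t); rewrite ?padP //; try lia.
by apply/tP => // u uo; apply: Z.
Qed.

End Hardness.

(** * Membership *)

Lemma eq_degree_compat (F : fieldType) (k : nat) (C : circuit F k) (w w' : 'I_k -> nat)
    (d : node C -> nat) : w =1 w' -> degree_compat w' d -> degree_compat w d.
Proof.
by move=> ww' h v; move: (h v); case: (label v) => // i ->; rewrite ww'.
Qed.

(** Gradings add. When coordinates of z replace both x and t, the z-degree of a gate is its x-degree
    plus its t-degree. *)
Lemma degree_compatD (F : fieldType) (k : nat) (C : circuit F k) (w w1 w2 : 'I_k -> nat)
    (d1 d2 : node C -> nat) : (forall i, w i = w1 i + w2 i)%N ->
  degree_compat w1 d1 -> degree_compat w2 d2 ->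
  degree_compat w (fun v => d1 v + d2 v)%N.
Proof.
move=> ww h1 h2 v; move: (h1 v) (h2 v); case: (label v) => [i|a||].
- by move=> -> ->.
- by move=> -> ->.
- by move=> {}h1 {}h2 e ev; rewrite h1 ?h2.
- by move=> -> ->; rewrite -big_split.
Qed.

Section Membership.
Variables (c n m : nat) (F : fieldType).
Hypotheses (c0 : (0 < c)%N) (n0 : (0 < n)%N) (m0 : (0 < m)%N).

Local Notation s := (s_param n m).
Local Notation UC := (univ_ctrl c n m n s F).
Local Notation N := (N_ctrl c n m).

(* If z = x (x) t, then the i-th row and the j-th column of z represent the
   points [t] and [x] whenever they are nonzero; a single pair (i, j) is not
   enough, since z_{i,j} may vanish. *)
Definition row_col_var (ij : 'I_n * 'I_N) (k : 'I_(n + m + N)) : 'I_(n * N + m) :=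
  match split k with
  | inl xy => match split xy with
              | inl i => lshift m (mxvec_index i ij.2)
              | inr y => rshift (n * N) y
              end
  | inr j => lshift m (mxvec_index ij.1 j)
  end.

(** The submatrix is read row by row: k < 2 selects the first row and odd k the second column, as
    [minor_circuit] expects. *)
Definition minor_var (q : 'I_n * 'I_n * ('I_N * 'I_N)) (k : 'I_4) : 'I_(n * N + m) :=
  lshift m (mxvec_index (if (k < 2)%N then q.1.1 else q.1.2)
                        (if odd k then q.2.2 else q.2.1)).

Definition segre_circuit : circuit F (n * N + m) :=
  juxt (copies row_col_var UC) (copies minor_var (minor_circuit F)).

Let acU : acyclic UC := @univ_ctrl_acyclic c n m n s F.
Let acA : acyclic (copies row_col_var UC) := copies_acyclic acU.
Let acB : acyclic (copies minor_var (minor_circuit F)) :=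
  copies_acyclic (@minor_acyclic F).

Definition z_col (z : 'rV[F]_(n * N)) (j : 'I_N) : 'rV[F]_n := \row_i z 0 (mxvec_index i j).
Definition z_row (z : 'rV[F]_(n * N)) (i : 'I_n) : 'rV[F]_N := \row_j z 0 (mxvec_index i j).

Lemma segre_circuit_zeroP (z : 'rV[F]_(n * N)) (y : 'rV[F]_m) :
  (forall v, v \in outputs segre_circuit -> meval_row (gate_poly v) (row_mx z y) = 0) <->
  (forall i j v, v \in outputs UC ->
     meval_row (gate_poly v) (row_mx (row_mx (z_col z j) y) (z_row z i)) = 0) /\
  (forall i i' j j', z 0 (mxvec_index i j) * z 0 (mxvec_index i' j') =
     z 0 (mxvec_index i j') * z 0 (mxvec_index i' j)).
Proof.
have evA i j (v : node UC) :
    meval_row (gate_poly (inl ((i, j), v) : node segre_circuit)) (row_mx z y) =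
    meval_row (gate_poly v) (row_mx (row_mx (z_col z j) y) (z_row z i)).
  rewrite /meval_row (juxt_evall _ acA acB) (copies_eval _ _ acU).
  apply: meval_eq => k /=; rewrite /row_col_var.
  rewrite -[k in RHS]splitK; case: (split k) => l /=; last by rewrite row_mxEl row_mxEr mxE.
  rewrite row_mxEl -[l in RHS]splitK; case: (split l) => u /=.
    by rewrite !row_mxEl mxE.
  by rewrite !row_mxEr.
have evB q : meval_row (gate_poly (inr (q, inr tt) : node segre_circuit)) (row_mx z y) =
    z 0 (mxvec_index q.1.1 q.2.1) * z 0 (mxvec_index q.1.2 q.2.2) -
    z 0 (mxvec_index q.1.1 q.2.2) * z 0 (mxvec_index q.1.2 q.2.1).
  rewrite /meval_row (juxt_evalr _ acA acB) (copies_eval _ _ (@minor_acyclic F)) minor_eval /=.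
  by rewrite /minor_var !inordK // !row_mxEl.
split=> [Z|[Z1 Z2] [[[i j] v]|[q v]]].
- split=> [i j v vo|i i' j j'].
    by rewrite -evA; apply: Z; rewrite juxt_outputs copies_outputs.
  apply/eqP; rewrite -subr_eq0; apply/eqP.
  rewrite -(evB (i, i', (j, j'))); apply: Z; rewrite juxt_outputs copies_outputs inE.
  by apply/forallP; case.
- by rewrite juxt_outputs copies_outputs => /Z1; rewrite evA.
- rewrite juxt_outputs copies_outputs => /minor_outputs ->.
  by rewrite evB Z2 subrr.
Qed.

Lemma segre_image_resultantP z :
  segre_image (@R_nm F c n m) z <-> exists q, zero_set2 segre_circuit z q.
Proof.
split=> [[x [t [p [w [xp tw [q Z] xtz]]]]]|[q Z]]; last first.
  have [u uz] := represents_ex z; have [y yq] := represents_ex q.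
  have [Z1 Z2] := (segre_circuit_zeroP u y).1 (Z u y uz yq).
  have [u0 _] := andP uz; have [e ue] := row_neq0 u0.
  (* At a nonzero entry z_ij, column j and row i are both nonzero; they serve as x and t. *)
  move: ue; case/mxvec_indexP: e => i j uij.
  have x0 : z_col u j != 0.
    by apply: contraNneq uij => /rowP /(_ i); rewrite !mxE => ->.
  have t0 : z_row u i != 0.
    by apply: contraNneq uij => /rowP /(_ j); rewrite !mxE => ->.
  have [p xp] := represents_exists_point x0; have [w tw] := represents_exists_point t0.
  exists (z_col u j), (z_row u i), p, w; split=> //.
    exists q; apply/(univ_zero_setP n0 n0 xp yq tw) => o; apply: Z1.
    exact: out_gate_output.
  (* The minors say z_kj z_il = z_kl z_ij, so the product of the column and the row is z_ij times
     z. *)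
  have -> : mxvec (\matrix_(k, l) (z_col u j 0 k * z_row u i 0 l)) = u 0 (mxvec_index i j) *: u.
    apply/rowP => e; case/mxvec_indexP: e => k l.
    by rewrite mxvecE !mxE (Z2 k i j l) mulrC.
  exact: representsZ.
exists q => z' y z'z yq; apply/segre_circuit_zeroP.
have [a a0 ->] := represents_proportional xtz z'z.
rewrite -/(segre x t); split=> [i j v vo|i i' j j']; last first.
  by rewrite !mxE !mxvecE !mxE; ring.
have -> : z_col (a *: segre x t) j = (a * t 0 j) *: x.
  by apply/rowP => k; rewrite !mxE segreE; ring.
have -> : z_row (a *: segre x t) i = (a * x 0 i) *: t.
  by apply/rowP => k; rewrite !mxE segreE; ring.
by rewrite -[y]scale1r; apply: univ_ctrl_scale; apply: Z.
Qed.

Definition segre_degree1 (v : node segre_circuit) : nat :=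
  match v with
  | inl v => controlled_degree 0 (@univ_degree c n m n s F fst) v.2 +
             controlled_degree 1 (@univ_ctrl_degree c n m n s F) v.2
  | inr v => minor_degree 1 v.2
  end.

Definition segre_degree2 (v : node segre_circuit) : nat :=
  match v with
  | inl v => controlled_degree 0 (@univ_degree c n m n s F snd) v.2
  | inr v => minor_degree 0 v.2
  end.

Lemma segre_circuit_homog (v : node segre_circuit) :
  bihomog_of (segre_degree1 v, segre_degree2 v) (gate_poly v).
Proof.
have ac := juxt_acyclic acA acB.
split; apply: (degree_compat_homog ac); apply: juxt_degree_compat.
- apply: (@copies_degree_compat _ _ _ _ row_col_var UC _ (fun _ v =>
    controlled_degree 0 (@univ_degree c n m n s F fst) v +
    controlled_degree 1 (@univ_ctrl_degree c n m n s F) v)%N) => ij.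
  apply: (degree_compatD _ (@ctrl_weight_compat c n m n s F fst (fun _ _ => erefl))
    (@ctrl_weight_compat_t c n m n s F)).
  move=> k; rewrite /ctrl_weight /wt1 /wt2 /row_col_var /= /input_level.
  by case: (split k) => [l|j]; [case: (split l) => i|]; rewrite ?split_lshift ?split_rshift.
- apply: (@copies_degree_compat _ _ _ _ minor_var _ _ (fun _ => @minor_degree F 1)) => q.
  apply: minor_degree_compat => k.
  by rewrite /wt1 /minor_var /= split_lshift.
- apply: (@copies_degree_compat _ _ _ _ row_col_var UC _ (fun _ v =>
    controlled_degree 0 (@univ_degree c n m n s F snd) v)) => ij.
  apply: (eq_degree_compat _ (@ctrl_weight_compat c n m n s F snd (fun _ _ => erefl))).
  move=> k; rewrite /ctrl_weight /wt2 /row_col_var /= /input_level.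
  by case: (split k) => [l|j]; [case: (split l) => i|]; rewrite ?split_lshift ?split_rshift.
- apply: (@copies_degree_compat _ _ _ _ minor_var _ _ (fun _ => @minor_degree F 0)) => q.
  apply: minor_degree_compat => k.
  by rewrite /wt2 /minor_var /= split_lshift.
Qed.

Lemma segre_circuit_bihomogeneous : bihomogeneous_circuit segre_circuit.
Proof.
split; last by move=> v; apply/bihomogeneousP; eexists; apply: segre_circuit_homog.
apply: juxt_is_circuit; apply: copies_is_circuit; last exact: minor_is_circuit.
apply: controlled_is_circuit; apply: univ_circuit_is_circuit => //.
by rewrite /s_param; lia.
Qed.

Lemma segre_circuit_output_degree : (output_degree segre_circuit <= 10 * n + 3)%N.
Proof.
(* The x- and y-degrees contribute n each and the controls 8n; the constant absorbs the extra
   control of a middle gate and the degree 2 of a minor. *)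
apply/bigmax_leqP => v _; apply: leq_trans (bihomog_msize (segre_circuit_homog v)) _.
have le_univ := @univ_level_le c n m n s F ^~ n0.
case: v => [[ij [[v|e]|e]]|[q [[bb|b]|u]]] /=; rewrite ?muln0; try lia.
- by have [h1 [h2 h3]] := le_univ v; lia.
- by have [h1 [h2 h3]] := le_univ (univ_src e); lia.
Qed.

(** * Polynomial bounds on the number of gates and edges *)

Definition nprod_bound : nat := (n.+1 * n.+1 * (n.+1 * n.+1) * (n.+1 * n.+1) * (c * s))%N.
Definition nsum_bound : nat := (nprod_bound * 2 + n.+1 * n.+1 * n)%N.
Definition N_bound : nat :=
  ((n + m) * nsum_bound + nprod_bound * nsum_bound + nprod_bound * 2)%N.

Lemma card_sig_le (T : finType) (P : pred T) : (#|{: {x | P x}}| <= #|T|)%N.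
Proof. by rewrite card_sig max_card. Qed.

Lemma card_prod_gate_le : (#|prod_gate c n s| <= nprod_bound)%N.
Proof. by apply: leq_trans (card_sig_le _) _; rewrite !card_prod !card_ord. Qed.

Lemma card_sum_gate_le : (#|sum_gate c n n s| <= nsum_bound)%N.
Proof.
rewrite card_sum !card_prod card_bool card_ord leq_add // leq_mul ?card_prod_gate_le //.
by apply: leq_trans (card_sig_le _) _; rewrite !card_prod !card_ord.
Qed.

Lemma N_ctrl_le : (N <= N_bound)%N.
Proof.
rewrite /N_ctrl /nctrl !card_sum; apply: leq_add; first apply: leq_add.
- by apply: leq_trans (card_sig_le _) _; rewrite card_prod card_ord leq_mul ?card_sum_gate_le.
- apply: leq_trans (card_sig_le _) _.
  by rewrite card_prod leq_mul ?card_sum_gate_le ?card_prod_gate_le.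
- by rewrite card_prod card_bool leq_mul ?card_prod_gate_le.
Qed.

Lemma N_ctrl_gt0 : (0 < N)%N.
Proof.
have lt1 : (1 < n.+1)%N by [].
pose R : {R : level n | bd R != (0, 0)%N} := exist _ (Ordinal lt1, ord0) isT.
pose g : sum_gate c n n s := inr (R, Ordinal n0).
have P : sum_level g == input_level (lshift m (Ordinal n0)) by rewrite /input_level split_lshift.
pose e : in_edge c n m n s := exist _ (lshift m (Ordinal n0), g) P.
by apply/card_gt0P; exists (inl (inl e)).
Qed.

Lemma segre_circuit_size : (circuit_size segre_circuit <=
  n * N_bound * (3 * N_bound) + n * n * (N_bound * N_bound) * 6)%N.
Proof.
rewrite /circuit_size card_sum !card_prod !card_ord.
have -> : #|edge UC| = (N + N + N)%N by rewrite 2!card_sum.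
have -> : #|edge (minor_circuit F)| = 6 by rewrite card_sum card_prod card_bool.
have := N_ctrl_le; set B := N_bound => leNB.
rewrite leq_add // leq_mul // ?leq_mul //; lia.
Qed.

Lemma segre_circuit_outputs : (#|outputs segre_circuit| <=
  n * N_bound * (n + m + nsum_bound + nprod_bound + 2 * N_bound) +
  n * n * (N_bound * N_bound) * 7)%N.
Proof.
(* Outputs are counted crudely among all gates. *)
apply: leq_trans (max_card _) _.
rewrite card_sum !card_prod !card_ord.
have -> : #|node UC| =
    (n + m + #|sum_gate c n n s| + #|prod_gate c n s| + N + N)%N.
  by rewrite 2!card_sum; congr (_ + _ + _)%N; rewrite 2!card_sum card_ord.
have -> : #|node (minor_circuit F)| = 7 by rewrite 2!card_sum card_prod card_bool card_unit.
have := N_ctrl_le; have := card_sum_gate_le; have := card_prod_gate_le.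
set B := N_bound => leP leS leNB.
rewrite leq_add // leq_mul // ?leq_mul //.
rewrite mulSn mul1n addnA; do 4?[apply: leq_add => //].
Qed.

End Membership.

(** * Completeness along the enumeration of pairs *)

Lemma diag_pair_le (k : nat) : ((diag_pair k).1 + (diag_pair k).2 <= k + 2)%N.
Proof.
(* Positivity of the second entry is carried along, because it makes the passage to a new diagonal
   raise the sum by only 1. *)
suff /(_ k.-1)/andP [_] : forall i, (0 < (iter i diag_next (1, 1)).2)%N &&
    ((iter i diag_next (1, 1)).1 + (iter i diag_next (1, 1)).2 <= i + 2)%N.
  by move=> H; apply: leq_trans H _; lia.
elim=> //= i; rewrite /diag_next; case: (iter _ _ _) => u v /=.
by case: ifP => /=; lia.
Qed.

Theorem theorem1p19 :
  exists c0 : nat, (1 <= c0)%N /\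
    forall c : nat, (c0 <= c)%N ->
    forall F : fieldType, NP_proj_complete (segre_resultant_seq F c).
Proof.
(* Any c >= 1 works, since a program has at most one product per edge of the original circuit and s
   is at least n. *)
exists 1%N; split=> // c c_gt0 F.
have pos1 k : (0 < (diag_pair k).1)%N by have /andP [] := diag_pair_gt0 k.
have pos2 k : (0 < (diag_pair k).2)%N by have /andP [] := diag_pair_gt0 k.
have coord_gt0 k : (0 < ncoord (segre_resultant_seq F c) k)%N.
  by rewrite /= muln_gt0 pos1 N_ctrl_gt0.
split.
  have bd1 : poly_bounded (fun k => (diag_pair k).1).
    apply: poly_bounded_le (poly_boundedD poly_bounded_id (poly_bounded_const 2)) _ => k.
    by apply: leq_trans (diag_pair_le k); apply: leq_addr.
  have bd2 : poly_bounded (fun k => (diag_pair k).2).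
    apply: poly_bounded_le (poly_boundedD poly_bounded_id (poly_bounded_const 2)) _ => k.
    by apply: leq_trans (diag_pair_le k); apply: leq_addl.
  have bdS : poly_bounded (fun k => (diag_pair k).1.+1).
    by apply: poly_bounded_le (poly_boundedD bd1 (poly_bounded_const 1)) _ => k; rewrite addn1.
  have bds : poly_bounded (fun k => s_param (diag_pair k).1 (diag_pair k).2).
    by do 2?[apply: poly_boundedD => //]; apply: poly_boundedX.
  have bdP : poly_bounded (fun k => nprod_bound c (diag_pair k).1 (diag_pair k).2).
    by do 6?[apply: poly_boundedM => //]; apply: poly_bounded_const.
  have bdsum : poly_bounded (fun k => nsum_bound c (diag_pair k).1 (diag_pair k).2).
    by apply: poly_boundedD; do 3?[apply: poly_boundedM => //]; apply: poly_bounded_const.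
  have bdN : poly_bounded (fun k => N_bound c (diag_pair k).1 (diag_pair k).2).
    apply: poly_boundedD; last by apply: poly_boundedM => //; apply: poly_bounded_const.
    by apply: poly_boundedD; apply: poly_boundedM => //; apply: poly_boundedD.
  have bnN := poly_boundedM bd1 bdN.
  have bnnNN := poly_boundedM (poly_boundedM bd1 bd1) (poly_boundedM bdN bdN).
  have b3 := poly_boundedM (poly_bounded_const 3) bdN.
  have b2 := poly_boundedM (poly_bounded_const 2) bdN.
  have bsum := poly_boundedD (poly_boundedD (poly_boundedD (poly_boundedD bd1 bd2) bdsum) bdP) b2.
  have ambient : ambient_ok (ncoord (segre_resultant_seq F c)).
    split; last by move=> k _; apply: coord_gt0.
    apply: poly_bounded_le (poly_boundedM bd1 bdN) _ => k.
    by rewrite leq_mul // N_ctrl_le.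
  split=> //; exists (fun k => (diag_pair k).2).
  exists (fun k => zero_set2 (segre_circuit c (diag_pair k).1 (diag_pair k).2 F)).
  split; last first.
    by move=> k _ z; apply: (@segre_image_resultantP c _ _ F (pos1 k) z).
  split=> //; first by split=> [|k _]; [exact: bd2 | exact: pos2].
  exists (fun k => segre_circuit c (diag_pair k).1 (diag_pair k).2 F); split=> //.
  - have bound := poly_boundedD (poly_boundedM bnN b3)
      (poly_boundedM bnnNN (poly_bounded_const 6)).
    by apply: (poly_bounded_le bound) => k; apply: segre_circuit_size.
  - have bound := poly_boundedD (poly_boundedM bnN bsum)
      (poly_boundedM bnnNN (poly_bounded_const 7)).
    by apply: (poly_bounded_le bound) => k; apply: segre_circuit_outputs.
  - have bound := poly_boundedD (poly_boundedM (poly_bounded_const 10) bd1)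
      (poly_bounded_const 3).
    by apply: (poly_bounded_le bound) => k; apply: segre_circuit_output_degree.
  - by move=> k _; apply: segre_circuit_bihomogeneous.
move=> X [[bdX posX] [k2 [Y [[_ [bdk2 posk2] [C [bdsz bdo bddeg homC zC]]] XY]]]].
(* For hardness, n dominates all parameters of the given circuit at once, and the summand 2 provides
   level (2,0); m is the number of y-coordinates, which are not padded. *)
pose n k := (ncoord X k + circuit_size (C k) + #|outputs (C k)| + output_degree (C k) + 2)%N.
pose p k := diag_pos (n k) (k2 k).
have rhoP k : {rho : proj F (ncoord X k) -> proj F (ncoord (segre_resultant_seq F c) (p k)) |
    (0 < k)%N -> projective_linear rho /\ forall a, pset (rho a) <-> pset a}.
  apply: constructive_indefinite_description.
  (* Index 0 carries no condition, but [rho] must be total; a constant map is used there. *)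
  have [k0|k_gt0] := posnP k.
    have [v v0] : exists v : 'rV[F]_(ncoord (segre_resultant_seq F c) (p k)), v != 0.
      exists (delta_mx 0 (Ordinal (coord_gt0 (p k)))); apply/eqP => /rowP.
      by move=> /(_ (Ordinal (coord_gt0 (p k)))) /eqP; rewrite !mxE !eqxx oner_eq0.
    have [z _] := represents_exists_point v0.
    by exists (fun=> z) => k_gt0; lia.
  have [le1 le2 le3] : [/\ ncoord X k <= n k, 2 <= n k & circuit_size (C k) <= n k]%N.
    by rewrite /n; split; lia.
  have [le4 le5] : (#|outputs (C k)| <= n k)%N /\ (output_degree (C k) <= n k)%N.
    by rewrite /n; split; lia.
  have [rho [lin rhoP]] :=
    segre_resultant_reduction c_gt0 (homC k k_gt0) le1 le2 le3 le4 le5.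
  have E : diag_pair (p k) = (n k, k2 k).
    by apply: diag_pairK; [rewrite /n; lia | apply: posk2].
  rewrite /= E; exists rho => _; split=> // a.
  rewrite rhoP XY //; split=> -[q hq]; exists q; exact/zC.
exists p, (fun k => sval (rhoP k)); split; last first.
  move=> k k_gt0; have [lin rhoE] := svalP (rhoP k) k_gt0; split=> //.
  by rewrite /p /diag_pos /n; lia.
have bdn : poly_bounded n.
  exact: poly_boundedD (poly_boundedD (poly_boundedD (poly_boundedD bdX bdsz) bdo) bddeg)
    (poly_bounded_const 2).
apply: (poly_bounded_le (poly_boundedX 2 (poly_boundedD bdn bdk2))) => k.
exact: diag_pos_quadratic.
Qed.
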